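(* Let $\mathcal{H},\mathcal{K}$ be complex Hilbert spaces, let $B\in\mathcal{B}(\mathcal{K},\mathcal{H})$ and, for $\lambda\in\mathbb{R}$, let $$S_\lambda=\begin{pmatrix}\lambda I&B\\ B^{*}&0\end{pmatrix}:\mathcal{H}\oplus\mathcal{K}\to\mathcal{H}\oplus\mathcal{K},\qquad T_\lambda=(\lambda^{2}I+4BB^{*})^{1/2}.$$ Let $V\in\mathcal{B}(\mathcal{H},\mathcal{K})$ be the unique partial isometry such that $B^{*}=V(BB^{*})^{1/2}$, $R(V)=\overline{R(B^{*})}$ and $R(V^{*})=\overline{R(B)}$. With respect to $\mathcal{H}\oplus\mathcal{K}$: (i) If $\lambda\neq0$, then $$S_\lambda^{+}=\frac12\begin{pmatrix}\frac{T_\lambda+\lambda^{2}T_\lambda^{-1}+2\lambda I}{2}&B+\lambda T_\lambda^{-1}B\\ B^{*}+\lambda B^{*}T_\lambda^{-1}&2B^{*}T_\lambda^{-1}B\end{pmatrix}.$$ (ii) With $T:=T_1=(I+4BB^{*})^{1/2}$, $$P_{S_1^{+}}=\begin{pmatrix}\frac{I+T^{-1}}{2}&T^{-1}B\\ B^{*}T^{-1}&2B^{*}T^{-1}(I+T)^{-1}B\end{pmatrix}.$$ (iii) If $\lambda>0$, then $$P_{S_\lambda^{+}}=\begin{pmatrix}\frac{I+\lambda T_\lambda^{-1}}{2}&T_\lambda^{-1}B\\ B^{*}T_\lambda^{-1}&2B^{*}T_\lambda^{-1}(\lambda I+T_\lambda)^{-1}B\end{pmatrix}.$$ (iv) If $\lambda<0$,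 then $$P_{S_\lambda^{+}}=\begin{pmatrix}\frac{I+\lambda T_\lambda^{-1}}{2}&T_\lambda^{-1}B\\ B^{*}T_\lambda^{-1}&\frac{V(I-\lambda T_\lambda^{-1})V^{*}}{2}\end{pmatrix}.$$ (v) $$P_{S_0^{+}}=\frac12\begin{pmatrix}P_B&V^{*}\\ V&P_{B^{*}}\end{pmatrix}.$$
   Context: $\mathcal{B}(\mathcal{K},\mathcal{H})$ is the set of bounded linear operators from $\mathcal{K}$ to $\mathcal{H}$; $R(\cdot)$ denotes range. For a bounded self-adjoint operator $A$, $A^{+}=\frac{|A|+A}{2}$ is its positive part, where $|A|=(A^{*}A)^{1/2}$. For a bounded operator $A$, $P_A$ denotes the orthogonal projection onto $\overline{R(A)}$ (the support projection of $A$). *)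

(* Defs.v *)
(* The field of complex numbers is [R[i]] for [R : realType]. *)
From HB Require Import structures.
From mathcomp Require Import all_boot all_order all_algebra.
From mathcomp Require Import sesquilinear complex ring.
From mathcomp Require Import all_classical all_reals topology normedtype.

Set Implicit Arguments.
Unset Strict Implicit.
Unset Printing Implicit Defensive.

Import Order.TTheory GRing.Theory Num.Theory.
Import numFieldNormedType.Exports.

Local Open Scope classical_set_scope.
Local Open Scope ring_scope.

(* The inner product is linear in its first argument. *)
HB.mixin Record CompleteNormedModule_isHilbert (R : realType) V
    & CompleteNormedModule R[i] V := {
  dotp : {dot V for (@Num.conj R[i])};
  dotp_norm : forall x : V, dotp x x = `|x| ^+ 2
}.

#[short(type="hilbertType")]
HB.structure Definition Hilbert (R : realType) :=
  {V of CompleteNormedModule R[i] V & CompleteNormedModule_isHilbert R V}.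

Notation "''[' x , y ]" := (dotp x y) : ring_scope.

Section BoundedOperators.
Context {C : numFieldType} {U V : normedModType C}.

Definition bounded_op : {pred U -> V} := fun f =>
  `[< linear f /\ exists M : C, forall x, `|f x| <= M * `|x| >].

Record bop := BOp { bop_fun :> U -> V; bop_funP : bop_fun \in bounded_op }.

HB.instance Definition _ := [isSub for bop_fun].
HB.instance Definition _ := [Choice of bop by <:].

Lemma bounded_op_submod : submod_closed bounded_op.
Proof.
split=> [|a f g /asboolP[lf [M Mf]] /asboolP[lg [N Ng]]]; apply/asboolP.
  split; first by move=> a x y; rewrite /= scaler0 addr0.
  by exists 0 => x; rewrite /= normr0 mul0r.
split.
  move=> k x y; rewrite /= !fctE lf lg !scalerDr !scalerA (mulrC a k).
  by rewrite -!addrA; congr (_ + _); rewrite addrCA.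
exists (`|a| * M + N) => x; rewrite mulrDl -mulrA.
by apply: (le_trans (ler_normD _ _)); rewrite normrZ lerD ?ler_wpM2l.
Qed.

HB.instance Definition _ := GRing.isSubmodClosed.Build C (U -> V) bounded_op
  bounded_op_submod.
HB.instance Definition _ := [SubChoice_isSubLmodule of bop by <:].

Lemma bop_linear (f : bop) : linear f.
Proof. by case: f => f /= /asboolP[]. Qed.

HB.instance Definition _ (f : bop) :=
  GRing.isLinear.Build C U V *:%R f (@bop_linear f).

Lemma bop_bounded (f : bop) : exists M, forall x, `|f x| <= M * `|x|.
Proof. by case: f => f /= /asboolP[]. Qed.

End BoundedOperators.
Arguments bop {C} U V.

Notation "''B' ( U , V )" := (bop U V) (format "''B' ( U ,  V )") : type_scope.

Section BasicOperators.
Context {C : numFieldType}.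
Implicit Types U V W : normedModType C.

Lemma bop_mk_subproof U V (f : U -> V) : linear f ->
  (exists M : C, forall x, `|f x| <= M * `|x|) -> f \in bounded_op.
Proof. by move=> lf bf; apply/asboolP. Qed.

Lemma bop_ge0_bounded U V (f : 'B(U, V)) :
  exists2 M : C, 0 <= M & forall x, `|f x| <= M * `|x|.
Proof.
have [M fM] := bop_bounded f.
have [[x x0]|U0] := pselect (exists x : U, x != 0).
  have x_gt0 : 0 < `|x| by rewrite normr_gt0.
  by exists M => //; rewrite -(pmulr_lge0 _ x_gt0) (le_trans _ (fM x)).
exists 0 => // x; have [->|x0] := eqVneq x 0; first by rewrite linear0 !normr0 mulr0.
by case: U0; exists x.
Qed.

Lemma comp_bop_subproof U V W (A : 'B(V, W)) (B : 'B(U, V)) :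
  A \o B \in bounded_op.
Proof.
apply: bop_mk_subproof => [a x y|]; first by rewrite /= !linearP.
have [[M M0 AM] [N N0 BN]] := (bop_ge0_bounded A, bop_ge0_bounded B).
exists (M * N) => x /=; rewrite (le_trans (AM _))// -mulrA.
by rewrite ler_wpM2l.
Qed.

Definition comp_bop U V W (A : 'B(V, W)) (B : 'B(U, V)) : 'B(U, W) :=
  BOp (comp_bop_subproof A B).

Lemma id_bop_subproof U : @id U \in bounded_op.
Proof. by apply: bop_mk_subproof => //; exists 1 => x; rewrite mul1r. Qed.

Definition id_bop U : 'B(U, U) := BOp (@id_bop_subproof U).

(* Junk value [0] when [A] has no bounded inverse. *)
Definition inv_bop U V (A : 'B(U, V)) : 'B(V, U) :=
  xget 0 [set X | comp_bop X A = id_bop U /\ comp_bop A X = id_bop V].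

End BasicOperators.
Arguments id_bop {C U}.

Notation "A ** B" := (comp_bop A B)
  (at level 40, left associativity) : ring_scope.
Notation "\1" := id_bop : ring_scope.

(* [H * K] already carries the sup norm; [dsum] is the same vector space with *)
(* the Hilbert norm.                                                          *)
Definition dsum (R : realType) (H K : hilbertType R) : Type := (H * K)%type.

Section DirectSum.
Context (R : realType) (H K : hilbertType R).
Local Notation C := R[i].
Local Notation HK := (dsum H K).

HB.instance Definition _ := GRing.Lmodule.copy HK (H * K)%type.

Definition dsum_dot (x y : HK) : C := '[x.1, y.1] + '[x.2, y.2].
Definition dsum_norm (x : HK) : C := sqrtC (`|x.1| ^+ 2 + `|x.2| ^+ 2).

Let sqr_sum_ge0 (x : HK) : 0 <= `|x.1| ^+ 2 + `|x.2| ^+ 2.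
Proof. by rewrite addr_ge0 ?exprn_ge0. Qed.

Let dsum_norm_ge0 (x : HK) : 0 <= dsum_norm x.
Proof. by rewrite sqrtC_ge0. Qed.

Let dsum_normK (x : HK) : dsum_norm x ^+ 2 = `|x.1| ^+ 2 + `|x.2| ^+ 2.
Proof. by rewrite sqrtCK. Qed.

Let dsum_normD (x y : HK) : dsum_norm (x + y) <= dsum_norm x + dsum_norm y.
Proof.
have CS : `|x.1| * `|y.1| + `|x.2| * `|y.2| <= dsum_norm x * dsum_norm y.
  rewrite -(@ler_pXn2r _ 2) ?nnegrE ?addr_ge0 ?mulr_ge0//.
  rewrite exprMn !dsum_normK -subr_ge0.
  rewrite [leRHS](_ : _ = (`|x.1| * `|y.2| - `|x.2| * `|y.1|) ^+ 2); last by ring.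
  by rewrite real_exprn_even_ge0// rpredB ?realM.
rewrite -(@ler_pXn2r _ 2) ?nnegrE ?addr_ge0//.
rewrite sqrrD !dsum_normK.
apply: (@le_trans _ _ ((`|x.1| + `|y.1|) ^+ 2 + (`|x.2| + `|y.2|) ^+ 2)).
  by rewrite lerD// lerXn2r ?nnegrE ?addr_ge0// ler_normD.
rewrite -subr_ge0 [leRHS](_ : _ =
  (dsum_norm x * dsum_norm y - (`|x.1| * `|y.1| + `|x.2| * `|y.2|)) *+ 2).
  by rewrite mulrn_wge0// subr_ge0.
by ring.
Qed.

Let dsum_normZ (a : C) (x : HK) : dsum_norm (a *: x) = `|a| * dsum_norm x.
Proof.
rewrite /dsum_norm !normrZ !exprMn -mulrDr sqrtCM ?nnegrE ?exprn_ge0//.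
by rewrite sqrCK.
Qed.

Let dsum_norm0_eq0 (x : HK) : dsum_norm x = 0 -> x = 0.
Proof.
move=> /eqP; rewrite sqrtC_eq0 paddr_eq0 ?exprn_ge0// !sqrf_eq0 !normr_eq0.
by case: x => x y /= /andP[/eqP-> /eqP->].
Qed.

HB.instance Definition _ :=
  Lmodule_isNormed.Build C HK dsum_normD dsum_normZ dsum_norm0_eq0.

Lemma dsum_normE (x : HK) : `|x| = sqrtC (`|x.1| ^+ 2 + `|x.2| ^+ 2).
Proof. by []. Qed.

Lemma dsum_norm_ge1 (x : HK) : `|x.1| <= `|x|.
Proof.
by rewrite -(@ler_pXn2r _ 2) ?nnegrE// dsum_normK lerDl exprn_ge0.
Qed.

Lemma dsum_norm_ge2 (x : HK) : `|x.2| <= `|x|.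
Proof.
by rewrite -(@ler_pXn2r _ 2) ?nnegrE// dsum_normK lerDr exprn_ge0.
Qed.

Lemma dsum_norm_le (x : HK) : `|x| <= `|x.1| + `|x.2|.
Proof.
rewrite -(@ler_pXn2r _ 2) ?nnegrE ?addr_ge0// dsum_normK sqrrD.
by rewrite -addrA lerD2l lerDr mulrn_wge0// mulr_ge0.
Qed.

Let dsum_complete (F : set_system HK) : ProperFilter F -> cauchy F -> cvg F.
Proof.
move=> FF /cauchy_ballP F_cauchy.
have c1 : cvg ((fun x : HK => x.1) @ F).
  apply: cauchy_cvg; apply/(cauchy_ballP (fmap _ F)) => e e0.
  rewrite near_map2; apply: filterS (F_cauchy _ e0) => -[x y] /=.
  by rewrite -!ball_normE /=; apply: le_lt_trans; exact: (dsum_norm_ge1 (x - y)).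
have c2 : cvg ((fun x : HK => x.2) @ F).
  apply: cauchy_cvg; apply/(cauchy_ballP (fmap _ F)) => e e0.
  rewrite near_map2; apply: filterS (F_cauchy _ e0) => -[x y] /=.
  by rewrite -!ball_normE /=; apply: le_lt_trans; exact: (dsum_norm_ge2 (x - y)).
apply/cvg_ex; exists ((lim ((fun x : HK => x.1) @ F),
                        lim ((fun x : HK => x.2) @ F)) : HK).
apply/cvgrPdist_lt => e e0; near=> x.
apply: (le_lt_trans (dsum_norm_le _)); rewrite [e]splitr ltrD//=.
- by near: x; move/cvgrPdist_lt : c1; apply; rewrite divr_gt0.
- by near: x; move/cvgrPdist_lt : c2; apply; rewrite divr_gt0.
Unshelve. all: by end_near. Qed.

HB.instance Definition _ := Uniform_isComplete.Build HK dsum_complete.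

Let dsum_dot_bilinear :
  bilinear_for *%R (@Num.conj C \; *%R) (dsum_dot : HK -> HK -> C).
Proof.
split=> [z a x y|z a x y].
  by rewrite /dsum_dot /= !linearPl/= mulrDr addrACA.
by rewrite /dsum_dot /= !linearPr/= mulrDr addrACA.
Qed.

HB.instance Definition _ := @bilinear_isBilinear.Build C HK HK C
  *%R (@Num.conj C \; *%R) dsum_dot dsum_dot_bilinear.

Let dsum_dot_hermitian (x y : HK) :
  dsum_dot x y = (-1) ^+ false * Num.conj (dsum_dot y x).
Proof.
rewrite expr0 mul1r /dsum_dot rmorphD/=.
by congr (_ + _); rewrite hermC expr0 mul1r.
Qed.

HB.instance Definition _ := isHermitianSesquilinear.Build C HK false
  (@Num.conj C) dsum_dot dsum_dot_hermitian.

Let dsum_dot_norm (x : HK) : dsum_dot x x = `|x| ^+ 2.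
Proof. by rewrite /dsum_dot !dotp_norm dsum_normK. Qed.

Let dsum_dot_gt0 (x : HK) : x != 0 -> 0 < dsum_dot x x.
Proof. by rewrite dsum_dot_norm => x0; rewrite exprn_gt0// normr_gt0. Qed.

HB.instance Definition _ := isDotProduct.Build C HK dsum_dot dsum_dot_gt0.

HB.instance Definition _ := CompleteNormedModule_isHilbert.Build R HK
  (dotp := dsum_dot : {dot HK for (@Num.conj C)}) dsum_dot_norm.

Lemma dsum_dotE (x y : HK) : '[x, y] = '[x.1, y.1] + '[x.2, y.2].
Proof. by []. Qed.

End DirectSum.

Section HilbertOperators.
Context {R : realType}.
Implicit Types H K : hilbertType R.

(* [adj], [sqrt_bop] and [supp_proj] pick the operator with the property that *)
(* determines it uniquely; the junk value is [0] if there is no such operator *)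
(* (which can only happen for [sqrt_bop A], when [A] is not positive).        *)

Definition adj H K (A : 'B(H, K)) : 'B(K, H) :=
  xget 0 [set A' : 'B(K, H) | forall x y, '[A x, y] = '[x, A' y]].

(* In [R[i]], [0 <= z] means that [z] is real and nonnegative. *)
Definition positive_bop H (A : 'B(H, H)) : Prop := forall x, 0 <= '[A x, x].

Definition sqrt_bop H (A : 'B(H, H)) : 'B(H, H) :=
  xget 0 [set P | positive_bop P /\ P ** P = A].

Definition abs_bop H K (A : 'B(H, K)) : 'B(H, H) :=
  sqrt_bop (adj A ** A).

Definition pos_part H (A : 'B(H, H)) : 'B(H, H) := 2^-1 *: (abs_bop A + A).

Definition is_orth_proj H (M : set H) (P : 'B(H, H)) : Prop :=
  [/\ adj P = P, P ** P = P & range P = M].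

Definition supp_proj H K (A : 'B(H, K)) : 'B(K, K) :=
  xget 0 [set P | is_orth_proj (closure (range A)) P].

Definition partial_isometry H K (V : 'B(H, K)) : Prop :=
  forall x, (forall z, V z = 0 -> '[x, z] = 0) -> `|V x| = `|x|.

End HilbertOperators.

Section BlockOperators.
Context {R : realType} {H K : hilbertType R}.
Variables (A : 'B(H, H)) (B : 'B(K, H)) (C : 'B(H, K)) (D : 'B(K, K)).

Let block_fun (x : dsum H K) : dsum H K :=
  (A x.1 + B x.2, C x.1 + D x.2).

Lemma block_bop_subproof : block_fun \in bounded_op.
Proof.
have [[a a0 aP] [b b0 bP]] := (bop_ge0_bounded A, bop_ge0_bounded B).
have [[c c0 cP] [d d0 dP]] := (bop_ge0_bounded C, bop_ge0_bounded D).
apply: bop_mk_subproof => [k x y|].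
  have E (u v : dsum H K) : u.1 = v.1 -> u.2 = v.2 -> u = v.
    by case: u v => [? ?] [? ?] /= -> ->.
  apply: E.
  - change (A (k *: x.1 + y.1) + B (k *: x.2 + y.2) =
      k *: (A x.1 + B x.2) + (A y.1 + B y.2)).
    by rewrite !linearP scalerDr addrACA.
  - change (C (k *: x.1 + y.1) + D (k *: x.2 + y.2) =
      k *: (C x.1 + D x.2) + (C y.1 + D y.2)).
    by rewrite !linearP scalerDr addrACA.
exists ((a + b) + (c + d)) => x.
apply: (le_trans (dsum_norm_le _)); rewrite !mulrDl.
have x1 := dsum_norm_ge1 x; have x2 := dsum_norm_ge2 x.
rewrite lerD//= (le_trans (ler_normD _ _))// lerD//.
- by rewrite (le_trans (aP _))// ler_wpM2l.
- by rewrite (le_trans (bP _))// ler_wpM2l.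
- by rewrite (le_trans (cP _))// ler_wpM2l.
- by rewrite (le_trans (dP _))// ler_wpM2l.
Qed.

(* The operator matrix [[A, B], [C, D]]. *)
Definition block_bop : 'B(dsum H K, dsum H K) := BOp block_bop_subproof.

Lemma block_bopE (x : dsum H K) :
  block_bop x = (A x.1 + B x.2, C x.1 + D x.2) :> H * K.
Proof. by []. Qed.

End BlockOperators.

Local Open Scope complex_scope.

Definition S_bop (R : realType) (H K : hilbertType R) (B : 'B(K, H)) (lam : R) :
    'B(dsum H K, dsum H K) :=
  block_bop (lam%:C *: \1) B (adj B) 0.

Definition T_bop (R : realType) (H K : hilbertType R) (B : 'B(K, H)) (lam : R) :
    'B(H, H) :=
  sqrt_bop ((lam ^+ 2)%:C *: \1 + 4 *: (B ** adj B)).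

(* Main.v *)
(* Put [T = T_lam], [X = (T + lam) / 2] and [Y = (T - lam) / 2], so that
   [X Y = B B^*] and [X + Y = T], and let [Z = (X  B)], [Z' = (Y  -B)] be the
   associated operators from [H + K] to [H].  Then [Z Z'^* = 0],
   [Z Z^* = X T], [Z' Z'^* = Y T] and
     [S_lam = Z^* T^-1 Z - Z'^* T^-1 Z'],
   a difference of two positive operators with product zero; hence
   [S_lam^+ = Z^* T^-1 Z] by uniqueness of positive square roots.  For [lam > 0]
   the operator [X] is invertible and the support projection is
   [Z^* (Z Z^* )^-1 Z]; for [lam < 0] it is the projection [1 + V V^*] onto the
   closure of the range of [S_lam], minus the corresponding projection
   [Z'^* (Z' Z'^* )^-1 Z'] of the negative part.  For [lam = 0] the same scheme
   works with [Z = (1  V^* )], [Z' = (1  -V^* )], and [(B B^* )^(1/2)] in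
   place of [T^-1]. *)
From HB Require Import structures.
Require Import Defs.
From mathcomp Require Import all_boot all_order all_algebra.
From mathcomp Require Import sesquilinear complex ring lra.
From mathcomp Require Import all_classical all_reals topology normedtype.

Set Implicit Arguments.
Unset Strict Implicit.
Unset Printing Implicit Defensive.

Import Order.TTheory GRing.Theory Num.Theory.
Import numFieldNormedType.Exports.

Local Open Scope classical_set_scope.
Local Open Scope ring_scope.
Local Open Scope complex_scope.

(** * Inner products *)

Section RealPart.
Context {R : realType} {H : hilbertType R}.
Implicit Types (x y z : H) (a b : R[i]).

(* The order of [R[i]] is partial, so [lra] only applies to these real
   versions. *)
Definition rdot x y : R := complex.Re '[x, y].
Definition nrm x : R := complex.Re `|x|.

Lemma nrmC x : (nrm x)%:C = `|x|.
Proof. by rewrite RRe_real// normr_real. Qed.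

Lemma nrm_ge0 x : 0 <= nrm x.
Proof. by rewrite -lecR nrmC normr_ge0. Qed.

Lemma dotC x y : '[x, y] = Num.conj '[y, x].
Proof. by rewrite hermC expr0 mul1r. Qed.

Lemma dotDl x y z : '[x + y, z] = '[x, z] + '[y, z].
Proof. by rewrite linearDl. Qed.
Lemma dotDr x y z : '[x, y + z] = '[x, y] + '[x, z].
Proof. by rewrite linearDr. Qed.
Lemma dotBl x y z : '[x - y, z] = '[x, z] - '[y, z].
Proof. by rewrite linearBl. Qed.
Lemma dotBr x y z : '[x, y - z] = '[x, y] - '[x, z].
Proof. by rewrite linearBr. Qed.
Lemma dotNl x y : '[- x, y] = - '[x, y].
Proof. by rewrite linearNl. Qed.
Lemma dotNr x y : '[x, - y] = - '[x, y].
Proof. by rewrite linearNr. Qed.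
Lemma dot0l x : '[0, x] = 0.
Proof. by rewrite linear0l. Qed.
Lemma dot0r x : '[x, 0] = 0.
Proof. by rewrite linear0r. Qed.
Lemma dotZl a x y : '[a *: x, y] = a * '[x, y].
Proof. by rewrite linearZl_LR. Qed.
Lemma dotZr a x y : '[x, a *: y] = Num.conj a * '[x, y].
Proof. by rewrite linearZr_LR. Qed.

Lemma conjc_conj a : Num.conj a = a^*%C. Proof. by []. Qed.
Lemma conjR (r : R) : Num.conj r%:C = r%:C.
Proof. by rewrite conjc_conj conjc_real. Qed.

Lemma rdotC x y : rdot x y = rdot y x.
Proof. by rewrite /rdot dotC; case: '[y, x]. Qed.
Lemma rdotDl x y z : rdot (x + y) z = rdot x z + rdot y z.
Proof. by rewrite /rdot dotDl raddfD. Qed.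
Lemma rdotDr x y z : rdot x (y + z) = rdot x y + rdot x z.
Proof. by rewrite /rdot dotDr raddfD. Qed.
Lemma rdotNl x y : rdot (- x) y = - rdot x y.
Proof. by rewrite /rdot dotNl raddfN. Qed.
Lemma rdotNr x y : rdot x (- y) = - rdot x y.
Proof. by rewrite /rdot dotNr raddfN. Qed.
Lemma rdotZl (r : R) x y : rdot (r%:C *: x) y = r * rdot x y.
Proof. by rewrite /rdot dotZl; case: '[x, y] => a b /=;
  rewrite mul0r subr0. Qed.
Lemma rdotZr (r : R) x y : rdot x (r%:C *: y) = r * rdot x y.
Proof. by rewrite rdotC rdotZl rdotC. Qed.
Lemma rdotxx x : rdot x x = nrm x ^+ 2.
Proof. by rewrite /rdot dotp_norm -nrmC -rmorphXn. Qed.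

(** Real parts suffice: the choice [z = x - y] makes the norm of [x - y] vanish. *)
Lemma dot_eqP x y : (forall z, rdot x z = rdot y z) -> x = y.
Proof.
move=> xy; apply/subr0_eq/eqP; rewrite -normr_eq0 -nrmC.
have : rdot (x - y) (x - y) = 0 by rewrite rdotDl rdotNl xy subrr.
by rewrite rdotxx => /eqP; rewrite sqrf_eq0 => /eqP->.
Qed.

Lemma nrm_eq0 x : nrm x = 0 -> x = 0.
Proof. by move=> x0; apply/eqP; rewrite -normr_eq0 -nrmC x0. Qed.

Lemma nrm0 : nrm (0 : H) = 0.
Proof. by rewrite /nrm normr0. Qed.

Lemma nrmZ (r : R) x : nrm (r%:C *: x) = `|r| * nrm x.
Proof.
apply: complexI; rewrite rmorphM /= !nrmC normrZ normc_def /=.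
by rewrite expr0n addr0 sqrtr_sqr.
Qed.

Lemma nrmN x : nrm (- x) = nrm x.
Proof. by rewrite /nrm normrN. Qed.

Lemma nrmD x y : nrm (x + y) <= nrm x + nrm y.
Proof. by rewrite -lecR rmorphD /= !nrmC ler_normD. Qed.

Lemma nrmB x y : nrm (x - y) = nrm (y - x).
Proof. by rewrite /nrm distrC. Qed.

Lemma nrm_tri z x y : nrm (x - y) <= nrm (x - z) + nrm (z - y).
Proof. by rewrite -[x - y](subrKA z) nrmD. Qed.

Lemma rdot_CS x y : rdot x y <= nrm x * nrm y.
Proof.
have [y0|y0] := eqVneq (nrm y) 0.
  by rewrite y0 mulr0 (nrm_eq0 y0) /rdot dot0r.
have ypos : 0 < nrm y ^+ 2 by rewrite exprn_gt0// lt_def y0 nrm_ge0.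
apply: le_trans (ler_norm _) _.
rewrite -(@ler_pXn2r _ 2) ?nnegrE ?mulr_ge0 ?nrm_ge0// real_normK ?num_real//.
(* Cauchy-Schwarz from one square: [x] minus its projection along [y], scaled by [nrm y ^+ 2] to
   avoid a division. *)
have : 0 <= nrm ((nrm y ^+ 2)%:C *: x - (rdot x y)%:C *: y) ^+ 2.
  by rewrite sqr_ge0.
rewrite -rdotxx !(rdotDl, rdotDr, rdotNl, rdotNr, rdotZl, rdotZr) !rdotxx.
rewrite (rdotC y x) => h; rewrite -(ler_pM2l ypos) exprMn; nra.
Qed.

(** Reduction to the real case: replacing [y] by ['[x, y] *: y] makes the inner product equal to the
    real number [|'[x, y]| ^+ 2]. *)
Lemma dot_CS x y : `|'[x, y]| <= `|x| * `|y|.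
Proof.
have [->|c0] := eqVneq '[x, y] 0; first by rewrite normr0 mulr_ge0.
rewrite -(@ler_pM2l _ `|'[x, y]|) ?normr_gt0// mulrCA -(normrZ _ y) -expr2.
have -> : `|'[x, y]| ^+ 2 = (rdot x ('[x, y] *: y))%:C.
  by rewrite /rdot dotZr conjc_conj mulrC -sqr_normc normc_def -rmorphXn.
by rewrite -!nrmC -rmorphM /= lecR rdot_CS.
Qed.

End RealPart.

(** * Limits and orthogonal projections *)

Section Limits.
Context {R : realType} {H : hilbertType R}.
Implicit Types (x y z l : H) (u v : nat -> H) (D : set H).

(** The topology of [H] has radii in [R[i]]; positive ones are real, so real epsilons suffice
    below. *)
Lemma posC (e : R[i]) : 0 < e -> 0 < complex.Re e /\ (complex.Re e)%:C = e.
Proof.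
move=> e0; have ee : (complex.Re e)%:C = e by rewrite RRe_real// gtr0_real.
by rewrite -ltcR ee.
Qed.

Lemma ballC x y (e : R) : ball x e%:C y <-> nrm (x - y) < e.
Proof. by rewrite -ball_normE /ball_ /= -ltcR nrmC. Qed.

Lemma closureP D x :
  closure D x <-> forall e : R, 0 < e -> exists2 y, D y & nrm (x - y) < e.
Proof.
split=> [Dx e e0|Dx N /nbhs_ballP[e /= /posC[e0 <-] xN]].
  have /Dx[y [Dy /ballC xy]] : nbhs x (ball x e%:C).
    by apply: nbhsx_ballx; rewrite ltcR.
  by exists y.
by have [y Dy xy] := Dx _ e0; exists y; split=> //; apply/xN/ballC.
Qed.

Definition seq_lim u l :=
  forall e : R, 0 < e -> exists N, forall n, (N <= n)%N -> nrm (u n - l) < e.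

(** Completeness of [H] enters the proof here. *)
Lemma cauchy_seq_lim u :
  (forall e : R, 0 < e -> exists N, forall m n, (N <= m)%N -> (N <= n)%N ->
     nrm (u m - u n) < e) -> exists l, seq_lim u l.
Proof.
move=> cu; have /cauchy_cvgP/cvg_ex[l ul] : cauchy (u @ \oo).
  apply: cauchy_exP => e /posC[/cu[N uN] <-]; exists (u N).
  by exists N => // n /= Nn; apply/ballC/uN.
exists l => e e0; have e0C : 0 < e%:C by rewrite ltcR.
have /cvgrPdist_lt/(_ _ e0C)[N _ uN] := ul.
by exists N => n /uN /=; rewrite -nrmC ltcR nrmB.
Qed.

Lemma seq_lim_unique u l l' : seq_lim u l -> seq_lim u l' -> l = l'.
Proof.
move=> ul ul'; apply/subr0_eq/nrm_eq0/eqP; rewrite eq_le nrm_ge0 andbT.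
apply/ler_addgt0Pr => e e0; rewrite add0r.
have e20 : 0 < e / 2 by lra.
have [N uN] := ul _ e20; have [N' uN'] := ul' _ e20.
have := uN (maxn N N') (leq_maxl _ _); have := uN' (maxn N N') (leq_maxr _ _).
have := nrm_tri (u (maxn N N')) l l'; rewrite (nrmB l (u _)); lra.
Qed.

Lemma eps_inv (e : R) : 0 < e ->
  exists N, forall n, (N <= n)%N -> n.+1%:R^-1 < e.
Proof.
move=> e0; exists (Num.trunc e^-1) => n Nn.
rewrite invf_plt ?posrE// (lt_le_trans (truncnS_gt _))//.
by rewrite ler_nat ltnS.
Qed.

Lemma seq_lim_nrm_le u l (c : R) N :
  seq_lim u l -> (forall n, (N <= n)%N -> nrm (u n) <= c) -> nrm l <= c.
Proof.
move=> ul uc; apply/ler_addgt0Pr => e e0; have [N' uN] := ul _ e0.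
have := uN (maxn N N') (leq_maxr _ _); have := uc (maxn N N') (leq_maxl _ _).
have := nrmD (u (maxn N N')) (l - u (maxn N N')).
by rewrite addrC subrK (nrmB l (u _)); lra.
Qed.

End Limits.

Section LimitOps.
Context {R : realType} {H K : hilbertType R}.
Implicit Types (u v : nat -> H).

Lemma bop_nrm (A : 'B(H, K)) : exists2 M : R, 0 < M &
  forall x, nrm (A x) <= M * nrm x.
Proof.
have [M M0 AM] := bop_ge0_bounded A.
have ME : (complex.Re M)%:C = M by rewrite RRe_real// ger0_real.
have ReM0 : 0 <= complex.Re M by rewrite -lecR ME.
exists (complex.Re M + 1); first by rewrite ltr_wpDl.
move=> x; apply: le_trans (_ : complex.Re M * nrm x <= _).
  by rewrite -lecR rmorphM /= !nrmC ME.
by rewrite ler_wpM2r ?nrm_ge0// lerDl.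
Qed.

Lemma seq_lim_bop (A : 'B(H, K)) u l : seq_lim u l -> seq_lim (A \o u) (A l).
Proof.
move=> ul e e0; have [M M0 AM] := bop_nrm A.
have [N uN] := ul _ (divr_gt0 e0 M0); exists N => n /uN.
by rewrite ltr_pdivlMr// mulrC; apply: le_lt_trans; rewrite -linearB /= AM.
Qed.

Lemma closure_bop0 (A : 'B(H, K)) (D : set H) x :
  (forall y, D y -> A y = 0) -> closure D x -> A x = 0.
Proof.
move=> A0 /closureP Dx; apply/nrm_eq0/eqP; rewrite eq_le nrm_ge0 andbT.
apply/ler_addgt0Pr => e e0; rewrite add0r.
have [M M0 AM] := bop_nrm A; have [y /A0 Ay xy] := Dx _ (divr_gt0 e0 M0).
have := AM (x - y); rewrite linearB /= Ay subr0 => /le_trans; apply.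
by rewrite mulrC -ler_pdivlMr// ltW.
Qed.

End LimitOps.

(** * Orthogonal projection onto the closure of a subspace *)

Section Projection.
Context {R : realType} {H : hilbertType R}.
Implicit Types (x y z l : H) (D : set H).

(** The real part of ['[x, 'i *: y]] is the imaginary part of ['[x, y]], so stability of [D] under
    scalars upgrades real orthogonality to complex orthogonality. *)
Lemma dot_eq0P x (D : set H) : (forall a y, D y -> D (a *: y)) ->
  (forall y, D y -> rdot x y = 0) -> forall y, D y -> '[x, y] = 0.
Proof.
move=> DZ xD y Dy; have := xD _ (DZ 'i%C _ Dy); have := xD _ Dy.
rewrite /rdot dotZr conjc_conj; case: '[x, y] => a b /= ->.
by rewrite mulr0 sub0r mulN1r opprK => ->.
Qed.

Lemma parallelogram x y z : nrm (y - z) ^+ 2 =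
  2 * nrm (x - y) ^+ 2 + 2 * nrm (x - z) ^+ 2 -
  4 * nrm (x - (2^-1)%:C *: (y + z)) ^+ 2.
Proof.
rewrite -!rdotxx !(rdotDl, rdotDr, rdotNl, rdotNr, rdotZl, rdotZr).
rewrite (rdotC y x) (rdotC z x) (rdotC z y); lra.
Qed.

(** Here [m] is the point of the closure of [D] nearest to [x]: a minimizing sequence is Cauchy by
    the parallelogram identity, and minimality at its limit forces orthogonality. [D] itself may
    fail to be closed. *)
Lemma orth_decomposition D x : D 0 ->
  (forall a y z, D y -> D z -> D (a *: y + z)) ->
  exists2 m, closure D m & forall d, D d -> '[x - m, d] = 0.
Proof.
move=> D0 DL.
have DZ a y : D y -> D (a *: y) by move=> Dy; rewrite -[_ *: _]addr0; apply: DL.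
have DD y z : D y -> D z -> D (y + z) by move=> Dy Dz; rewrite -[y]scale1r;
  apply: DL.
pose E := [set nrm (x - d) | d in D]; pose rho := inf E.
have E0 : E !=set0 by exists (nrm (x - 0)); exists 0.
have Elb : lbound E 0 by move=> _ [z _ <-]; exact: nrm_ge0.
have rhoE d : D d -> rho <= nrm (x - d).
  by move=> Dd; apply: ge_inf; [exists 0|exists d].
have rho0 : 0 <= rho by apply: lb_le_inf.
have /choice[d dP] (n : nat) : exists d, D d /\ nrm (x - d) < rho + n.+1%:R^-1.
  have [||_ [z Dz <-] zP] := @inf_adherent _ E n.+1%:R^-1; last by exists z.
  - by rewrite invr_gt0.
  - by split=> //; exists 0.
have [|m dm] := @cauchy_seq_lim _ _ d.
  (* With errors [s, t < 1] the identity gives a squared distance of at most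
     [4 rho (s + t) + 2 (s^2 + t^2)], hence at most [(4 rho + 2) (s + t)]; this is below [e ^+ 2]
     once each of [s], [t] is below [e ^+ 2 / (8 rho + 4)]. *)
  move=> e e0; have e'0 : 0 < Num.min 1 (e ^+ 2 / (8 * rho + 4)).
    by rewrite lt_min ltr01 divr_gt0 ?exprn_gt0//; lra.
  have [N NP] := eps_inv e'0; exists N => i j Ni Nj.
  have [[Di xi] [Dj xj]] := (dP i, dP j).
  have := rhoE _ (DZ (2^-1)%:C _ (DD _ _ Di Dj)).
  move: (NP _ Ni) (NP _ Nj); rewrite !lt_min !ltr_pdivlMr; try lra.
  have s0 : 0 < i.+1%:R^-1 :> R by rewrite invr_gt0.
  have t0 : 0 < j.+1%:R^-1 :> R by rewrite invr_gt0.
  move: (i.+1%:R^-1) (j.+1%:R^-1) s0 t0 xi xj => s t s0 t0 xi xj /andP[s1 se]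
    /andP[t1 te].
  have := nrm_ge0 (x - d i); have := nrm_ge0 (x - d j).
  have := parallelogram x (d i) (d j).
  move: (nrm (x - d i)) (nrm (x - d j)) (nrm (x - _ *: _)) xi xj => p q r xi xj.
  move=> E1 q0 p0 rr.
  rewrite -(@ltr_pXn2r _ 2) ?nnegrE ?nrm_ge0 ?ltW// E1.
  have : p ^+ 2 < (rho + s) ^+ 2 by rewrite ltr_pXn2r ?nnegrE//; lra.
  have : q ^+ 2 < (rho + t) ^+ 2 by rewrite ltr_pXn2r ?nnegrE//; lra.
  have : rho ^+ 2 <= r ^+ 2 by rewrite ler_pXn2r ?nnegrE//; lra.
  nra.
exists m.
  apply/closureP => e /dm[N dN]; exists (d N); first by case: (dP N).
  by rewrite nrmB dN.
have xm : nrm (x - m) <= rho.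
  apply/ler_addgt0Pr => e e0; have e20 : 0 < e / 2 by lra.
  have [N dN] := dm _ e20; have [N' N'P] := eps_inv e20.
  have := dN _ (leq_maxl N N'); have := N'P _ (leq_maxr N N').
  have := nrm_tri (d (maxn N N')) x m; have [_] := dP (maxn N N').
  by move: (_.+1%:R^-1) => s; lra.
have rhom y : D y -> rho <= nrm (x - m - y).
  move=> Dy; apply/ler_addgt0Pr => e /dm[N dN].
  have := rhoE _ (DD _ _ (dP N).1 Dy); have := dN _ (leqnn N).
  have := nrmD (x - m - y) (m - d N).
  by rewrite addrAC subrKA -addrA -opprD (nrmB m); lra.
apply: dot_eq0P => // y Dy.
(* First variation along [y]. The optimal coefficient has denominator [nrm y ^+ 2]; adding 1 allows
   [y = 0] and still gives a strict decrease unless [rdot (x - m) y = 0]. *)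
have : nrm (x - m) ^+ 2 <=
    nrm (x - m - (rdot (x - m) y / (nrm y ^+ 2 + 1))%:C *: y) ^+ 2.
  rewrite ler_pXn2r ?nnegrE ?nrm_ge0//; apply: le_trans xm _.
  exact/rhom/DZ.
move: (x - m) => w.
rewrite -!rdotxx !(rdotDl, rdotDr, rdotNl, rdotNr, rdotZl, rdotZr) (rdotC y w).
rewrite !rdotxx; move: (rdot w y) (sqr_ge0 (nrm y)) => r.
move: (nrm y ^+ 2) (nrm w ^+ 2) => q p q0.
rewrite -subr_ge0 (_ : _ - _ = - (r ^+ 2 * (q + 2)) / (q + 1) ^+ 2); last first.
  by field; lra.
rewrite mulNr oppr_ge0 pmulr_lle0 ?invr_gt0 ?exprn_gt0//; last lra.
rewrite pmulr_lle0; last lra.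
by move=> r0; apply/eqP; rewrite -sqrf_eq0 eq_le r0 sqr_ge0.
Qed.

End Projection.

(** * Bounded operators and adjoints *)

Section BopAlgebra.
Context {R : realType}.
Implicit Types H K L G : hilbertType R.

Lemma bop_ext H K (A B : 'B(H, K)) : A =1 B -> A = B.
Proof. by move=> AB; apply/val_inj/funext. Qed.

Lemma bopDE H K (A B : 'B(H, K)) x : (A + B) x = A x + B x. Proof. by []. Qed.
Lemma bopNE H K (A : 'B(H, K)) x : (- A) x = - A x. Proof. by []. Qed.
Lemma bopZE H K a (A : 'B(H, K)) x : (a *: A) x = a *: A x. Proof. by []. Qed.
Lemma bop0E H K x : (0 : 'B(H, K)) x = 0. Proof. by []. Qed.
Lemma idE H (x : H) : (\1 : 'B(H, H)) x = x. Proof. by []. Qed.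
Lemma compE H K L (A : 'B(K, L)) (B : 'B(H, K)) x : (A ** B) x = A (B x).
Proof. by []. Qed.

Lemma op0 H K (A : 'B(H, K)) : A 0 = 0. Proof. exact: linear0. Qed.
Lemma opD H K (A : 'B(H, K)) x y : A (x + y) = A x + A y.
Proof. exact: linearD. Qed.
Lemma opN H K (A : 'B(H, K)) x : A (- x) = - A x. Proof. exact: linearN. Qed.
Lemma opB H K (A : 'B(H, K)) x y : A (x - y) = A x - A y.
Proof. exact: linearB. Qed.
Lemma opZ H K (A : 'B(H, K)) a x : A (a *: x) = a *: A x.
Proof. by rewrite linearZ. Qed.

Lemma compA H K L G (A : 'B(L, G)) (B : 'B(K, L)) (C : 'B(H, K)) :
  A ** (B ** C) = A ** B ** C.
Proof. exact: bop_ext. Qed.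
Lemma comp1l H K (A : 'B(H, K)) : \1 ** A = A.
Proof. exact: bop_ext. Qed.
Lemma comp1r H K (A : 'B(H, K)) : A ** \1 = A.
Proof. exact: bop_ext. Qed.
Lemma comp0l H K L (A : 'B(H, K)) : (0 : 'B(K, L)) ** A = 0.
Proof. exact: bop_ext. Qed.
Lemma comp0r H K L (A : 'B(K, L)) : A ** (0 : 'B(H, K)) = 0.
Proof. by apply: bop_ext => x; rewrite compE linear0. Qed.
Lemma compDl H K L (A B : 'B(K, L)) (C : 'B(H, K)) :
  (A + B) ** C = A ** C + B ** C.
Proof. exact: bop_ext. Qed.
Lemma compDr H K L (A : 'B(K, L)) (B C : 'B(H, K)) :
  A ** (B + C) = A ** B + A ** C.
Proof. by apply: bop_ext => x; rewrite compE !bopDE linearD. Qed.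
Lemma compNl H K L (A : 'B(K, L)) (C : 'B(H, K)) : (- A) ** C = - (A ** C).
Proof. exact: bop_ext. Qed.
Lemma compNr H K L (A : 'B(K, L)) (C : 'B(H, K)) : A ** (- C) = - (A ** C).
Proof. by apply: bop_ext => x; rewrite compE !bopNE linearN. Qed.
Lemma compZl H K L a (A : 'B(K, L)) (C : 'B(H, K)) :
  (a *: A) ** C = a *: (A ** C).
Proof. exact: bop_ext. Qed.
Lemma compZr H K L a (A : 'B(K, L)) (C : 'B(H, K)) :
  A ** (a *: C) = a *: (A ** C).
Proof. by apply: bop_ext => x; rewrite compE !bopZE linearZ. Qed.

Lemma bop_mk H K (f : H -> K) : linear f ->
  (exists M : R, forall x, nrm (f x) <= M * nrm x) ->
  exists A : 'B(H, K), forall x, A x = f x.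
Proof.
move=> lf [M fM].
have fP : f \in bounded_op.
  by apply: bop_mk_subproof lf _; exists M%:C => x;
    rewrite -!nrmC -rmorphM lecR.
by exists (BOp fP).
Qed.

Lemma dot_ext H (x y : H) : (forall z, '[x, z] = '[y, z]) -> x = y.
Proof. by move=> xy; apply: dot_eqP => z; rewrite /rdot xy. Qed.

(** The component [w] of [x] orthogonal to the kernel of [f] represents [f] up to a scalar, since
    [v - (f v / f w) *: w] lies in the kernel for every [v]. *)
Lemma riesz H (f : {scalar H}) (M : R[i]) :
  (forall x, `|f x| <= M * `|x|) -> exists y, forall x, f x = '[x, y].
Proof.
move=> fM; have [[x fx]|f0] := pselect (exists x, f x != 0); last first.
  exists 0 => x; rewrite dot0r; apply/eqP/negP => fx; apply: f0.
  by exists x; apply/negP.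
have [|a y z fy fz|m] := @orth_decomposition _ _ [set z | f z = 0] x.
- exact: linear0.
- by rewrite /= linearP fy fz /= mulr0 addr0.
(* The kernel of a bounded functional is closed: a kernel point within [|f m| / (M + 1)] of [m]
   would give [|f m| < |f m|]. *)
move=> mD xm; have fm : f m = 0.
  apply/eqP/negP => /negP; rewrite -normr_gt0 => /posC[fm0 fmE].
  have MM : 0 <= M.
    have x0 : 0 < `|x| by rewrite normr_gt0; apply: contra_neq fx => ->;
      rewrite linear0.
    by rewrite -(pmulr_lge0 _ x0) (le_trans _ (fM x)).
  have ME : (complex.Re M)%:C = M by rewrite RRe_real// ger0_real.
  have M1 : 0 < complex.Re M + 1 by rewrite ltr_wpDl// -lecR ME.
  have [y fy my] := (closureP _ _).1 mD _ (divr_gt0 fm0 M1).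
  move: my; rewrite ltr_pdivlMr// ltNge => /negP; apply.
  rewrite -lecR fmE -[m](subrK y) linearD /= fy addr0 (le_trans (fM _))//.
  by rewrite rmorphM rmorphD /= ME nrmC subrK mulrC ler_wpM2l// lerDl.
pose w := x - m; have fw : f w != 0 by rewrite linearB /= fm subr0.
have w0 : '[w, w] != 0.
  by rewrite dotp_norm sqrf_eq0 normr_eq0; apply: contra_neq fw => ->;
    rewrite linear0.
exists (Num.conj (f w / '[w, w]) *: w) => v; rewrite dotZr conjCK.
have /xm : f (v - (f v / f w) *: w) = 0.
  by rewrite linearB linearZ /= divfK// subrr.
rewrite dotBr dotZr -/w => /eqP;
  rewrite subr_eq0 dotC => /eqP/(congr1 Num.conj).
rewrite conjCK rmorphM /= conjCK -dotC => ->.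
by field; rewrite fw.
Qed.

(** The adjoint exists, so [adj] never takes its default value: [adj A z] is the Riesz vector of [v
    |-> '[A v, z]]. *)
Lemma adjP H K (A : 'B(H, K)) x y : '[A x, y] = '[x, adj A y].
Proof.
suff [A' A'P] : exists A' : 'B(K, H), forall x y, '[A x, y] = '[x, A' y].
  rewrite /adj; case: xgetP => [B _ /= -> //|/(_ A')].
  by case.
have [M M0 AM] := bop_nrm A.
have /choice[f fP] (z : K) : exists w, forall v, '[A v, z] = '[v, w].
  pose g (v : H) := '[A v, z].
  have lg : scalar g by move=> a u v; rewrite /g linearP dotDl dotZl.
  pose gl : {scalar H} := HB.pack g (GRing.isLinear.Build _ _ _ _ _ lg).
  have [|w wP] := @riesz _ gl (M%:C * `|z|); last by exists w.
  move=> v; apply: le_trans (dot_CS _ _) _.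
  by rewrite mulrAC ler_wpM2r// -!nrmC -rmorphM lecR.
have [||A' A'P] := @bop_mk _ _ f.
- move=> a u v; apply: dot_ext => w; rewrite dotC [RHS]dotC; congr Num.conj.
  by rewrite -fP !(dotDr, dotZr) !fP.
(* Since ['[f v, f v] = '[A (f v), v]], Cauchy-Schwarz bounds [nrm (f v) ^+ 2] by
   [M * nrm (f v) * nrm v], and one factor cancels. *)
- exists M => v; have [->|v0] := eqVneq (nrm (f v)) 0.
    by rewrite mulr_ge0 ?nrm_ge0 ?ltW.
  rewrite -(@ler_pM2l _ (nrm (f v))); last by rewrite lt_def v0 nrm_ge0.
  rewrite -expr2 -rdotxx /rdot -fP; apply: le_trans (rdot_CS _ _) _.
  by rewrite mulrCA mulrA ler_wpM2r ?nrm_ge0.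
- by exists A' => u v; rewrite fP A'P.
Qed.

End BopAlgebra.

(** Pairing with an arbitrary vector turns a linear identity between vectors into a scalar
    identity. *)
Ltac vec := apply: dot_ext => ?; rewrite ?(dotDl, dotNl, dotZl, dot0l);
  first [ring | field].
Ltac opvec := apply: bop_ext => ?;
  rewrite ?(bopDE, bopNE, bopZE, bop0E, compE, idE, opD, opN, opZ, op0); vec.

(** * Adjoints, positive operators and inverses of self-adjoint operators *)

Section Adjoint.
Context {R : realType}.
Implicit Types H K L G : hilbertType R.

Lemma adj_unique H K (A : 'B(H, K)) (A' : 'B(K, H)) :
  (forall x y, '[A x, y] = '[x, A' y]) -> adj A = A'.
Proof.
move=> AA'; apply: bop_ext => y; apply: dot_ext => x.
by rewrite dotC [RHS]dotC -adjP AA'.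
Qed.

Lemma adj_runique H K (A : 'B(H, K)) (A' : 'B(K, H)) :
  (forall x y, rdot (A x) y = rdot x (A' y)) -> adj A = A'.
Proof.
move=> AA'; apply: bop_ext => y; apply: dot_eqP => x.
by rewrite rdotC [RHS]rdotC -AA' /rdot adjP.
Qed.

Lemma adjK H K (A : 'B(H, K)) : adj (adj A) = A.
Proof. by apply: adj_unique => x y; rewrite dotC -adjP -dotC. Qed.

Lemma adjPr H K (A : 'B(H, K)) x y : '[x, A y] = '[adj A x, y].
Proof. by rewrite adjP adjK. Qed.

Lemma radjP H K (A : 'B(H, K)) x y : rdot (A x) y = rdot x (adj A y).
Proof. by rewrite /rdot adjP. Qed.

Lemma adjD H K (A B : 'B(H, K)) : adj (A + B) = adj A + adj B.
Proof.
by apply: adj_unique => x y; rewrite !bopDE dotDl dotDr !adjP.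
Qed.

Lemma adjZ H K a (A : 'B(H, K)) : adj (a *: A) = Num.conj a *: adj A.
Proof.
by apply: adj_unique => x y; rewrite !bopZE dotZl dotZr conjCK !adjP.
Qed.

Lemma adjZr H K (r : R) (A : 'B(H, K)) : adj (r%:C *: A) = r%:C *: adj A.
Proof. by rewrite adjZ conjR. Qed.

Lemma adjN H K (A : 'B(H, K)) : adj (- A) = - adj A.
Proof. by apply: adj_unique => x y; rewrite !bopNE dotNl dotNr adjP. Qed.

Lemma adj0 H K : adj (0 : 'B(H, K)) = 0.
Proof. by apply: adj_unique => x y; rewrite !bop0E dot0l dot0r. Qed.

Lemma adj1 H : adj (\1 : 'B(H, H)) = \1.
Proof. exact: adj_unique. Qed.

Lemma adj_comp H K L (A : 'B(K, L)) (B : 'B(H, K)) :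
  adj (A ** B) = adj B ** adj A.
Proof. by apply: adj_unique => x y; rewrite !compE !adjP. Qed.

(** Complex polarization: the vectors [x + y] and [x + 'i *: y] give the sum and the difference of
    ['[A x, y]] and ['[A y, x]]. *)
Lemma dot_diag_eq0 H (A : 'B(H, H)) : (forall x, '[A x, x] = 0) -> A = 0.
Proof.
move=> A0; apply: bop_ext => x; apply: dot_ext => y; rewrite bop0E dot0l.
have := A0 (x + y); rewrite opD !(dotDl, dotDr) !A0 add0r addr0 => E1.
have := A0 (x + 'i%C *: y).
rewrite opD opZ !(dotDl, dotDr, dotZl, dotZr) !A0.
rewrite !mulr0 add0r addr0 conjc_conj.
have -> : '[A y, x] = - '[A x, y] by apply/eqP; rewrite -addr_eq0 addrC E1.
case: '[A x, y] => a b /= /eqP; rewrite eq_complex /= => /andP[/eqP h1 /eqP h2].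
by apply/eqP; rewrite eq_complex /=; apply/andP; split; apply/eqP; lra.
Qed.

Lemma positive_adj H (A : 'B(H, H)) : positive_bop A -> adj A = A.
Proof.
move=> A0; apply/subr0_eq/dot_diag_eq0 => x.
rewrite bopDE bopNE dotBl -adjPr dotC; apply/eqP; rewrite subr_eq0.
by apply/eqP; rewrite geC0_conj.
Qed.

Lemma positiveP H (A : 'B(H, H)) :
  positive_bop A <-> adj A = A /\ forall x, 0 <= rdot (A x) x.
Proof.
split=> [A0|[AA A0] x].
  by split=> [|x]; [exact: positive_adj|have := A0 x; rewrite lecE => /andP[]].
have : '[A x, x] = Num.conj '[A x, x] by rewrite -dotC -{2}AA adjP AA.
rewrite conjc_conj lecE; have := A0 x; rewrite /rdot.
case: '[A x, x] => a b /= -> /eqP;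
  rewrite eq_complex /= andbT => /andP[_ /eqP h].
by apply/eqP; lra.
Qed.

Lemma positive_conj H K (A : 'B(H, H)) (Z : 'B(K, H)) :
  positive_bop A -> positive_bop (adj Z ** A ** Z).
Proof. by move=> A0 x; rewrite !compE -adjPr A0. Qed.

Lemma positiveD H (A B : 'B(H, H)) :
  positive_bop A -> positive_bop B -> positive_bop (A + B).
Proof. by move=> A0 B0 x; rewrite bopDE dotDl addr_ge0. Qed.

Lemma positiveZ H (r : R) (A : 'B(H, H)) :
  0 <= r -> positive_bop A -> positive_bop (r%:C *: A).
Proof. by move=> r0 A0 x; rewrite bopZE dotZl mulr_ge0// ler0c. Qed.

Lemma positive1 H : positive_bop (\1 : 'B(H, H)).
Proof. by move=> x; rewrite dotp_norm exprn_ge0. Qed.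

Lemma positive_adj_comp H K (A : 'B(H, K)) : positive_bop (adj A ** A).
Proof. by rewrite -[adj A]comp1r; apply/positive_conj/positive1. Qed.

(* Positivity of [A] at the vector [x - M^-1 A x]. *)
Lemma positive_nrm H (A : 'B(H, H)) (M : R) : 0 < M ->
  (forall x, nrm (A x) <= M * nrm x) -> positive_bop A ->
  forall x, nrm (A x) ^+ 2 <= M * rdot (A x) x.
Proof.
move=> M0 AM /positiveP[AA A0] x.
have := A0 (x - (M^-1)%:C *: A x).
rewrite linearB linearZ /= !(rdotDl, rdotDr, rdotNl, rdotNr, rdotZl, rdotZr).
rewrite (radjP A (A x)) AA rdotxx.
have : rdot (A (A x)) (A x) <= M * nrm (A x) ^+ 2.
  apply: le_trans (rdot_CS _ _) _.
  by rewrite expr2 mulrA ler_wpM2r ?nrm_ge0.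
move: (rdot (A (A x)) (A x)) (rdot (A x) x) (nrm (A x) ^+ 2) => c a n cM.
rewrite [leRHS](_ : _ = (a * M ^+ 2 - 2 * n * M + c) / M ^+ 2); last first.
  by field; rewrite gt_eqF.
rewrite pmulr_lge0 ?invr_gt0 ?exprn_gt0// => h.
by rewrite -(ler_pM2l M0); nra.
Qed.

Lemma positive_ker H (A : 'B(H, H)) x :
  positive_bop A -> rdot (A x) x = 0 -> A x = 0.
Proof.
move=> A0 Ax; have [M M0 AM] := bop_nrm A.
have := positive_nrm M0 AM A0 x; rewrite Ax mulr0 => h.
by apply/nrm_eq0/eqP; rewrite -sqrf_eq0 eq_le h sqr_ge0.
Qed.

(** The lower bound gives injectivity and a closed range. The range is dense because its orthogonal
    complement is the kernel of [adj A = A]. *)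
Lemma selfadj_inv_ex H (A : 'B(H, H)) (c : R) : 0 < c -> adj A = A ->
  (forall x, c * nrm x <= nrm (A x)) ->
  exists X, X ** A = \1 /\ A ** X = \1.
Proof.
move=> c0 AA Ac.
have Ainj x : A x = 0 -> x = 0.
  move=> Ax; apply/nrm_eq0/eqP; rewrite eq_le nrm_ge0 andbT -(ler_pM2l c0).
  by rewrite (le_trans (Ac x))// Ax nrm0 mulr0.
have /choice[f fP] y : exists x, A x = y.
  have [|a u v|m mA ym] := @orth_decomposition _ _ (range A) y.
  - by exists 0; rewrite ?linear0.
  - by move=> [u' _ <-] [v' _ <-]; exists (a *: u' + v') => //; rewrite linearP.
  (* [y - m] is orthogonal to the range of [A], hence killed by [A]; so [y] is in the closure of the
     range. *)
  have {ym} my : y = m.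
    apply/subr0_eq/Ainj/dot_ext => z; rewrite dot0l adjP AA.
    by apply: ym; exists z.
  rewrite -{}my {m} in mA.
  have /choice[u uP] (n : nat) : exists x, nrm (y - A x) < n.+1%:R^-1.
    have [|_ [x _ <-] xP] := (closureP _ _).1 mA n.+1%:R^-1; last by exists x.
    by rewrite invr_gt0.
  have uy : seq_lim (A \o u) y.
    move=> e /eps_inv[N NP]; exists N => n /NP; rewrite nrmB.
    exact/lt_trans/uP.
  have [|x ux] := @cauchy_seq_lim _ _ u; last first.
    by exists x; apply: seq_lim_unique (seq_lim_bop A ux) uy.
  (* Preimages of a convergent sequence are Cauchy: [c] times their distance is at most the distance
     of the images. *)
  move=> e e0; have e'0 : 0 < c * e / 2 by rewrite divr_gt0// mulr_gt0.
  have [N NP] := uy _ e'0; exists N => i j Ni Nj.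
  rewrite -(ltr_pM2l c0) (le_lt_trans (Ac _))// linearB /=.
  have := NP _ Ni; have := NP _ Nj; have := nrm_tri y (A (u i)) (A (u j)).
  by rewrite /= (nrmB y); lra.
have Af y : f (A y) = y by apply/subr0_eq/Ainj; rewrite linearB /= fP subrr.
have [||X XP] := @bop_mk _ _ _ f.
- move=> a u v; apply/subr0_eq/Ainj.
  by rewrite linearB linearP /= !fP subrr.
- exists c^-1 => x; rewrite -(ler_pM2l c0) mulVKf ?gt_eqF//.
  by rewrite -{2}(fP x) Ac.
- by exists X; split; apply: bop_ext => x; rewrite compE XP ?fP ?Af.
Qed.

Lemma inv_bopE H K (A : 'B(H, K)) (X : 'B(K, H)) :
  X ** A = \1 -> A ** X = \1 -> inv_bop A = X.
Proof.
move=> XA AX; rewrite /inv_bop; case: xgetP => [Y _ [YA _]|/(_ X)/=];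
  last first.
  by case.
by rewrite -[Y]comp1r -AX compA YA comp1l.
Qed.

Lemma inv_bopP H (A : 'B(H, H)) (c : R) : 0 < c -> adj A = A ->
  (forall x, c * nrm x <= nrm (A x)) ->
  [/\ inv_bop A ** A = \1, A ** inv_bop A = \1 & adj (inv_bop A) = inv_bop A].
Proof.
move=> c0 AA /(selfadj_inv_ex c0 AA)[X [XA AX]].
rewrite (inv_bopE XA AX); split=> //.
have AX' : A ** adj X = \1 by rewrite -{1}AA -adj_comp XA adj1.
by rewrite -[adj X]comp1l -XA -compA AX' comp1r.
Qed.

End Adjoint.

(** * Positive square roots *)

Section SquareRoot.
Context {R : realType} {H : hilbertType R}.
Implicit Types (A C P Q Y : 'B(H, H)) (u v : nat -> H).

Lemma seq_limD u v l k : seq_lim u l -> seq_lim v k ->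
  seq_lim (fun n => u n + v n) (l + k).
Proof.
move=> ul vk e e0; have e20 : 0 < e / 2 by lra.
have [[N uN] [N' vN]] := (ul _ e20, vk _ e20).
exists (maxn N N') => n; rewrite geq_max => /andP[/uN un /vN vn].
by rewrite opprD addrACA (le_lt_trans (nrmD _ _))//; lra.
Qed.

(** This carries the self-adjointness of the iterates below over to their pointwise limit. *)
Lemma seq_lim_rdot u v l k x y : seq_lim u l -> seq_lim v k ->
  (forall n, rdot (u n) x = rdot y (v n)) -> rdot l x = rdot y k.
Proof.
move=> ul vk uv; apply/subr0_eq/eqP; rewrite -normr_le0.
apply/ler_addgt0Pr => e e0; rewrite add0r.
pose c := nrm x + nrm y + 1.
have c0 : 0 < c by have := nrm_ge0 x; have := nrm_ge0 y; rewrite /c; lra.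
have [[N uN] [N' vN]] := (ul _ (divr_gt0 e0 c0), vk _ (divr_gt0 e0 c0)).
have := uN _ (leq_maxl N N'); have := vN _ (leq_maxr N N').
have := uv (maxn N N'); move: (u _) (v _) => a b ab.
rewrite !ltr_pdivlMr// => bk al.
have := rdot_CS (a - l) x; have := rdot_CS (- (a - l)) x.
have := rdot_CS y (b - k); have := rdot_CS (- y) (b - k).
rewrite !nrmN !(rdotDl, rdotDr, rdotNl, rdotNr) ab.
have := nrm_ge0 x; have := nrm_ge0 y; have := nrm_ge0 (a - l).
have := nrm_ge0 (b - k); rewrite /c in bk al *.
move=> h1 h2 h3 h4 h5 h6 h7 h8; rewrite ler_norml; apply/andP; split; nra.
Qed.

(* Fixed-point iteration for [Y = (C + Y^2) / 2], i.e. [(1 - Y)^2 = 1 - C].  The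
   same iteration for the number [C = 1] increases to [1], and its increments
   dominate the norms of the increments of the operators when [|C| <= 1]. *)
Fixpoint sqrt_iter C n : 'B(H, H) :=
  if n is n.+1 then (2^-1)%:C *: (C + sqrt_iter C n ** sqrt_iter C n) else 0.

Fixpoint sqrt_bnd n : R :=
  if n is n.+1 then 2^-1 * (1 + sqrt_bnd n ^+ 2) else 0.

Lemma sqrt_iter0E C x : sqrt_iter C 0 x = 0. Proof. by []. Qed.
Lemma sqrt_iterSE C n x : sqrt_iter C n.+1 x =
  (2^-1)%:C *: (C x + sqrt_iter C n (sqrt_iter C n x)).
Proof. by []. Qed.
Lemma sqrt_bndS n : sqrt_bnd n.+1 = 2^-1 * (1 + sqrt_bnd n ^+ 2).
Proof. by []. Qed.

Lemma sqrt_bnd_ge0 n : 0 <= sqrt_bnd n.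
Proof. by case: n => //= n; rewrite mulr_ge0 ?addr_ge0 ?sqr_ge0 ?invr_ge0. Qed.

(** The gap [g = 1 - sqrt_bnd n] satisfies the recursion [g' = g - g^2 / 2], which decays like
    [2 / n]; the shift to [n + 2] gives equality at [n = 0]. *)
Lemma sqrt_bnd_rate n : 0 <= 1 - sqrt_bnd n <= 2 / n.+2%:R.
Proof.
elim: n => [|n /andP[]] /=; first by apply/andP; split; lra.
have := sqrt_bnd_ge0 n; move: (sqrt_bnd n) => b b0 b1 b2.
apply/andP; split; first by nra.
have n0 : 0 <= n%:R :> R by [].
move: b2; rewrite !ler_pdivlMr// -(natr1 n.+2) -(natr1 n.+1) -(natr1 n).
move: (n%:R) n0 b1 => t t0 b1 h.
have : 0 <= b * (2 - (1 - b) * (t + 1 + 1)) by rewrite mulr_ge0// subr_ge0.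
nra.
Qed.

Lemma sqrt_bnd_le m n : (m <= n)%N -> sqrt_bnd m <= sqrt_bnd n.
Proof.
move/subnK <-; elim: (n - m)%N => // k IH; apply: le_trans IH _.
rewrite addSn /=; have /andP[+ _] := sqrt_bnd_rate (k + m).
by have := sqrt_bnd_ge0 (k + m); move: (sqrt_bnd _) => b; nra.
Qed.

Variable C : 'B(H, H).
Hypothesis C1 : forall x, nrm (C x) <= nrm x.

Lemma sqrt_iter_nrm n x : nrm (sqrt_iter C n x) <= sqrt_bnd n * nrm x.
Proof.
elim: n x => [|n IH] x; first by rewrite sqrt_iter0E nrm0 mul0r.
rewrite sqrt_iterSE nrmZ ger0_norm ?invr_ge0// sqrt_bndS.
rewrite -mulrA ler_wpM2l ?invr_ge0//.
apply: le_trans (nrmD _ _) _; rewrite mulrDl mul1r lerD// (le_trans (IH _))//.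
by rewrite expr2 -mulrA ler_wpM2l ?sqrt_bnd_ge0.
Qed.

(** With [Y_n] the iterates, [Y_(n+1)^2 - Y_n^2 = Y_(n+1) (Y_(n+1) - Y_n) + (Y_(n+1) - Y_n) Y_n]
    without any commutation; bounding each factor gives the corresponding difference of squares for
    [sqrt_bnd]. *)
Lemma sqrt_iterS_nrm n x :
  nrm (sqrt_iter C n.+1 x - sqrt_iter C n x) <=
  (sqrt_bnd n.+1 - sqrt_bnd n) * nrm x.
Proof.
elim: n x => [|n IH] x.
  rewrite sqrt_iterSE !sqrt_iter0E addr0 subr0 nrmZ ger0_norm ?invr_ge0//.
  by rewrite sqrt_bndS expr0n addr0 mulr1 subr0 ler_wpM2l ?invr_ge0.
set y := sqrt_iter C n.+1 x - sqrt_iter C n x.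
set z := sqrt_iter C n x.
have -> : sqrt_iter C n.+2 x - sqrt_iter C n.+1 x =
    (2^-1)%:C *: (sqrt_iter C n.+1 y + (sqrt_iter C n.+1 z - sqrt_iter C n z)).
  rewrite sqrt_iterSE (sqrt_iterSE C n x) -scalerBr /y opB addrA subrK.
  by rewrite opprD addrACA subrr add0r.
rewrite nrmZ ger0_norm ?invr_ge0//.
have := nrmD (sqrt_iter C n.+1 y) (sqrt_iter C n.+1 z - sqrt_iter C n z).
have : nrm (sqrt_iter C n.+1 y) <=
    sqrt_bnd n.+1 * ((sqrt_bnd n.+1 - sqrt_bnd n) * nrm x).
  apply: le_trans (sqrt_iter_nrm _ _) _.
  by rewrite ler_wpM2l ?sqrt_bnd_ge0// IH.
have : nrm (sqrt_iter C n.+1 z - sqrt_iter C n z) <=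
    (sqrt_bnd n.+1 - sqrt_bnd n) * (sqrt_bnd n * nrm x).
  apply: le_trans (IH _) _.
  by rewrite ler_wpM2l ?sqrt_iter_nrm// subr_ge0 sqrt_bnd_le.
rewrite (sqrt_bndS n.+1) {5}(sqrt_bndS n).
move: (sqrt_bnd n.+1) (sqrt_bnd n) => p q.
nra.
Qed.

Lemma sqrt_iter_cauchy m n x : (m <= n)%N ->
  nrm (sqrt_iter C n x - sqrt_iter C m x) <= (sqrt_bnd n - sqrt_bnd m) * nrm x.
Proof.
move/subnK <-; elim: (n - m)%N => [|k IH].
  by rewrite !subrr nrm0 mul0r.
rewrite addSn (le_trans (nrm_tri (sqrt_iter C (k + m) x) _ _))//.
by have := sqrt_iterS_nrm (k + m) x; move: (sqrt_bnd _.+1) => b; lra.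
Qed.

Lemma sqrt_iter_limit x : exists l, seq_lim (sqrt_iter C ^~ x) l.
Proof.
apply: cauchy_seq_lim => e e0.
(* The tail after [N] is at most [2 / (N + 2)] times [nrm x], so this threshold gives [e / 2] on
   each side of the triangle inequality; adding 1 covers [x = 0]. *)
have e'0 : 0 < e / (4 * (nrm x + 1)).
  by have := nrm_ge0 x => x0; rewrite divr_gt0//; lra.
have [N NP] := eps_inv e'0.
have main i : (N <= i)%N -> nrm (sqrt_iter C i x - sqrt_iter C N x) < e / 2.
  move=> Ni; apply: le_lt_trans (sqrt_iter_cauchy _ Ni) _.
  have /andP[bi _] := sqrt_bnd_rate i; have /andP[_ bN] := sqrt_bnd_rate N.
  have : N.+2%:R^-1 < e / (4 * (nrm x + 1)).
    apply: le_lt_trans (NP _ (leqnn N)).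
    by rewrite lef_pV2 ?posrE ?ltr0n// ler_nat.
  have x0 := nrm_ge0 x.
  rewrite ltr_pdivlMr; last lra.
  have s0 : 0 <= N.+2%:R^-1 :> R by rewrite invr_ge0.
  move: (N.+2%:R^-1) s0 bN => s s0 bN sP.
  have bs : sqrt_bnd i - sqrt_bnd N <= 2 * s by lra.
  apply: le_lt_trans (ler_wpM2r x0 bs) _; lra.
exists N => i j Ni Nj.
have := nrm_tri (sqrt_iter C N x) (sqrt_iter C i x) (sqrt_iter C j x).
have := main _ Ni; have := main _ Nj.
by rewrite (nrmB (sqrt_iter C N x)); lra.
Qed.

(** [Y] is the pointwise limit of the iterates; each property holds along the iteration, by
    induction or by its recursion, and passes to the limit. *)
Lemma sqrt_contraction : adj C = C -> exists Y,
  [/\ adj Y = Y, forall x, nrm (Y x) <= nrm x, 2%:C *: Y = C + Y ** Y &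
      forall G, G ** C = C ** G -> G ** Y = Y ** G].
Proof.
move=> CC; have /choice[f fP] := sqrt_iter_limit.
have fle x : nrm (f x) <= nrm x.
  apply: (seq_lim_nrm_le (N := 0) (fP x)) => n _.
  apply: le_trans (sqrt_iter_nrm _ _) _; rewrite -[leRHS]mul1r.
  by rewrite ler_wpM2r ?nrm_ge0// -subr_ge0; case/andP: (sqrt_bnd_rate n).
have [||Y YP] := @bop_mk _ _ _ f.
- move=> a u v; apply: seq_lim_unique (fP _) _ => e e0.
  have [N NP] := seq_limD (seq_lim_bop (a *: \1) (fP u)) (fP v) e0.
  by exists N => n /NP; rewrite opD opZ.
- by exists 1 => x; rewrite mul1r fle.
have {}fP x : seq_lim (sqrt_iter C ^~ x) (Y x) by rewrite YP.
have {fle YP} Yle x : nrm (Y x) <= nrm x by rewrite YP.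
exists Y; split=> //.
- apply: adj_runique => x y; apply: (seq_lim_rdot (fP x) (fP y)) => n.
  rewrite radjP; congr rdot; elim: n y => [|n IH] y.
    by rewrite [sqrt_iter _ _]/= adj0.
  by rewrite [sqrt_iter _ _]/= adjZr adjD adj_comp CC !(bopZE, bopDE, compE)
    !IH.
- apply: bop_ext => x; rewrite bopZE bopDE compE.
  suff YxE : Y x = (2^-1)%:C *: (C x + Y (Y x)).
    by rewrite {1}YxE scalerA -rmorphM divff ?pnatr_eq0// scale1r.
  (* Both sides are limits of the shifted sequence of iterates at [x]. *)
  apply: (@seq_lim_unique _ _ (fun n => sqrt_iter C n.+1 x) (Y x)).
    by move=> e /(fP x)[N NP]; exists N => n Nn; exact: (NP n.+1 (leqW Nn)).
  apply: (seq_lim_bop ((2^-1)%:C *: \1) (u := fun n => C x + sqrt_iter C n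
    (sqrt_iter C n x))).
  apply: (@seq_limD (fun=> C x) _ (C x)).
    by move=> e e0; exists 0 => n _; rewrite subrr nrm0.
  (* Pointwise limits do not multiply in general; here the iterates [Y_n] are contractions, so
     [Y_n (Y_n x - Y x)] is small along with [Y_n (Y x) - Y (Y x)]. *)
  move=> e e0; have e20 : 0 < e / 2 by lra.
  have [[N NP] [N' NP']] := (fP x _ e20, fP (Y x) _ e20).
  exists (maxn N N') => n; rewrite geq_max => /andP[/NP + /NP'].
  have := sqrt_iter_nrm n (sqrt_iter C n x - Y x).
  have /andP[+ _] := sqrt_bnd_rate n; have := nrm_ge0 (sqrt_iter C n x - Y x).
  have := nrm_tri (sqrt_iter C n (Y x)) (sqrt_iter C n (sqrt_iter C n x)) (Y (Y
    x)).
  rewrite -opB; move: (sqrt_bnd n) => b; nra.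
- move=> G GC; have GCx x : G (C x) = C (G x) by rewrite -compE GC.
  apply: bop_ext => x; rewrite !compE.
  apply: seq_lim_unique (seq_lim_bop G (fP x)) _ => e /(fP (G x))[N NP].
  exists N => n /NP; suff <- : G (sqrt_iter C n x) = sqrt_iter C n (G x) by [].
  elim: n x {NP} => [|n IH] x; first by rewrite !sqrt_iter0E op0.
  by rewrite !sqrt_iterSE opZ opD GCx !IH.
Qed.

End SquareRoot.

Section SqrtBop.
Context {R : realType} {H : hilbertType R}.
Implicit Types (A C P Q Y : 'B(H, H)).

(* The last clause lets any other root [Q] of [A] commute with [P]. *)
Lemma positive_sqrt_ex A : positive_bop A -> exists P,
  [/\ positive_bop P, P ** P = A & forall G, G ** A = A ** G -> G ** P = P **
    G].
Proof.
move=> A0; have AA := positive_adj A0; have [M M0 AM] := bop_nrm A.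
(* [C = 1 - A / M] is a contraction because [nrm (A x) ^+ 2 <= M * rdot (A x) x]. The root is
   [sqrt M (1 - Y)], since [(1 - Y)^2 = 1 - C]. *)
have [||Y [YY Y1 YE Ycomm]] := @sqrt_contraction _ _ (\1 - M^-1%:C *: A).
- move=> x; rewrite -(@ler_pXn2r _ 2) ?nnegrE ?nrm_ge0// -!rdotxx.
  rewrite !(bopDE, bopNE, bopZE) idE.
  rewrite !(rdotDl, rdotDr, rdotNl, rdotNr, rdotZl, rdotZr) (rdotC x).
  have := positive_nrm M0 AM A0 x; have /positiveP[_ /(_ x)] := A0;
    rewrite !rdotxx.
  move: (rdot _ x) (nrm x ^+ 2) (nrm (A x) ^+ 2) => a x2 n a0 na.
  have : M^-1 * (M^-1 * n) <= M^-1 * a.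
    by apply: ler_wpM2l; rewrite ?ler_pdivrMl// invr_ge0 ltW.
  have : 0 <= M^-1 * a by rewrite mulr_ge0// invr_ge0 ltW.
  by move: (M^-1) => s; lra.
- by rewrite adjD adj1 adjN adjZr AA.
have MM : (Num.sqrt M)%:C * (Num.sqrt M)%:C = M%:C.
  by rewrite -rmorphM -expr2 sqr_sqrtr// ltW.
exists ((Num.sqrt M)%:C *: (\1 - Y)); split.
- apply: positiveZ; first exact: sqrtr_ge0.
  apply/positiveP; split=> [|x]; first by rewrite adjD adjN adj1 YY.
  rewrite bopDE bopNE rdotDl rdotNl subr_ge0 rdotxx.
  by rewrite (le_trans (rdot_CS _ _))// expr2 ler_wpM2r ?nrm_ge0.
- rewrite compZl compZr scalerA MM compDl comp1l compNl compDr comp1r compNr.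
  have -> : Y ** Y = 2%:C *: Y - (\1 - M^-1%:C *: A) by rewrite YE addrAC subrr
    add0r.
  rewrite rmorph_nat (_ : _ - _ = M^-1%:C *: A).
    by rewrite scalerA -rmorphM divff ?gt_eqF// scale1r.
  by opvec.
- move=> G GA; rewrite compZl compZr; congr (_ *: _).
  rewrite compDl compDr comp1l comp1r compNl compNr Ycomm//.
  by rewrite compDl compDr comp1l comp1r compNl compNr compZl compZr GA.
Qed.

(** With [D = P - Q], commutation gives [(P + Q) D = 0]. At [y = D x] both quadratic forms then
    vanish, so [P] and [Q] kill [y], and [nrm (D x) ^+ 2 = rdot x (D y) = 0]. *)
Lemma positive_sqrt_unique P Q : positive_bop P -> positive_bop Q ->
  P ** P = Q ** Q -> P ** Q = Q ** P -> P = Q.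
Proof.
move=> P0 Q0 PQ PQC; apply/subr0_eq/bop_ext => x; rewrite bop0E.
pose D := P - Q; rewrite -/D; pose y := D x.
have [PP QQ] := (positive_adj P0, positive_adj Q0).
have DD : adj D = D by rewrite adjD adjN PP QQ.
have /positiveP[_ /(_ y) Py] := P0; have /positiveP[_ /(_ y) Qy] := Q0.
have : (P + Q) ** D = 0.
  by rewrite compDl !compDr !compNr PQ PQC subrKA subrr.
move/(congr1 (fun A : 'B(H, H) => rdot (A x) y)).
rewrite compE -/y bopDE bop0E rdotDl {3}/rdot dot0l /= => PQy.
have {PQy} [Py0 Qy0] : rdot (P y) y = 0 /\ rdot (Q y) y = 0 by lra.
have Dy : D y = 0.
  by rewrite bopDE bopNE (positive_ker P0 Py0) (positive_ker Q0 Qy0) subrr.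
apply/nrm_eq0/eqP; rewrite -sqrf_eq0 -rdotxx radjP DD -/y Dy.
by rewrite /rdot dot0r.
Qed.

(** Any positive root [S] commutes with [A = S ** S], hence with the constructed root, which brings
    uniqueness among commuting roots to bear. *)
Lemma sqrt_bop_unique A P : positive_bop P -> P ** P = A -> sqrt_bop A = P.
Proof.
move=> P0 PA; have A0 : positive_bop A.
  by rewrite -PA -{1}(positive_adj P0); apply: positive_adj_comp.
have [Q [Q0 QA Qcomm]] := positive_sqrt_ex A0.
have QE S : positive_bop S -> S ** S = A -> S = Q.
  move=> S0 SA; apply: positive_sqrt_unique; rewrite ?QA//.
  by rewrite Qcomm// -SA compA.
rewrite (QE P)// /sqrt_bop; case: xgetP => [S _ [S0 SA]|/(_ P)/=]; last by case.
exact: QE.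
Qed.

Lemma sqrt_bopP A : positive_bop A -> [/\ positive_bop (sqrt_bop A),
  sqrt_bop A ** sqrt_bop A = A &
  forall G, G ** A = A ** G -> G ** sqrt_bop A = sqrt_bop A ** G].
Proof.
move=> /positive_sqrt_ex[P [P0 PA Pcomm]].
by rewrite (sqrt_bop_unique P0 PA).
Qed.

End SqrtBop.

(** * Support projections, positive parts and block operators *)

Section SupportProjection.
Context {R : realType}.
Implicit Types H K : hilbertType R.

Lemma conj_comp H K (A C : 'B(H, H)) (Y Z : 'B(K, H)) :
  adj Y ** A ** Y ** (adj Z ** C ** Z) =
  adj Y ** (A ** (Y ** adj Z ** C)) ** Z.
Proof. by rewrite !compA. Qed.

Lemma adj_conj H K (A : 'B(H, H)) (Z : 'B(K, H)) :
  adj (adj Z ** A ** Z) = adj Z ** adj A ** Z.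
Proof. by rewrite !adj_comp adjK compA. Qed.

(** Equal ranges give [P ** Q = Q] and [Q ** P = P]; taking adjoints identifies the two. *)
Lemma orth_proj_unique H (M : set H) P Q :
  is_orth_proj M P -> is_orth_proj M Q -> P = Q.
Proof.
move=> [PA PP PM] [QA QQ QM].
have PQ : P ** Q = Q.
  apply: bop_ext => x; rewrite compE.
  have [y _ <-] : range P (Q x) by rewrite PM -QM; exists x.
  by rewrite -compE PP.
have QP : Q ** P = P.
  apply: bop_ext => x; rewrite compE.
  have [y _ <-] : range Q (P x) by rewrite QM -PM; exists x.
  by rewrite -compE QQ.
by rewrite -QP -QA -PA -adj_comp PQ.
Qed.

Lemma supp_projE H K (A : 'B(H, K)) P :
  is_orth_proj (closure (range A)) P -> supp_proj A = P.
Proof.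
move=> hP; rewrite /supp_proj; case: xgetP => [Q _ /= hQ|/(_ P)//].
exact: orth_proj_unique hQ hP.
Qed.

(* A projection fixing [range A] whose kernel contains [ker (adj A)]: for [x]
   in its range, the component orthogonal to [range A] is killed. *)
Lemma supp_proj_unique H K (A : 'B(H, K)) P :
  adj P = P -> P ** P = P -> P ** A = A ->
  (forall x, adj A x = 0 -> P x = 0) -> supp_proj A = P.
Proof.
move=> PA PP PAA kerP; apply: supp_projE; split=> //.
have Pcl m : closure (range A) m -> P m = m.
  move=> Am; apply/subr0_eq; rewrite -[m in X in _ - X]idE -bopNE -bopDE.
  apply: closure_bop0 Am => _ [y _ <-].
  by rewrite bopDE bopNE idE -compE PAA subrr.
apply/seteqP; split=> [_ [x _ <-]|m /Pcl <-]; last by exists m.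
have [|a u v|m mA xm] := @orth_decomposition _ _ (range A) (P x).
- by exists 0; rewrite ?op0.
- by move=> [u' _ <-] [v' _ <-]; exists (a *: u' + v') => //; rewrite linearP.
suff -> : P x = m by [].
have /kerP : adj A (P x - m) = 0.
  apply: dot_ext => z; rewrite -adjPr dot0l.
  by apply: xm; exists z.
by rewrite opB -compE PP (Pcl m mA) => /subr0_eq.
Qed.

(** Both cross terms vanish, so [(P + N)^2 = P^2 + N^2 = (P - N)^2] and [P + N] is the modulus of
    [S]. *)
Lemma pos_part_decomp H (S P N : 'B(H, H)) :
  positive_bop P -> positive_bop N -> P ** N = 0 -> S = P - N ->
  pos_part S = P.
Proof.
move=> P0 N0 PN ->; have [PP NN] := (positive_adj P0, positive_adj N0).
have NP : N ** P = 0 by rewrite -NN -PP -adj_comp PN adj0.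
rewrite /pos_part /abs_bop (@sqrt_bop_unique _ _ _ (P + N)).
- rewrite (_ : _ + _ = 2 *: P); last by opvec.
  by rewrite scalerA mulVf ?pnatr_eq0// scale1r.
- exact: positiveD.
rewrite adjD adjN PP NN !(compDl, compDr, compNl, compNr) PN NP.
by rewrite !oppr0 !addr0 !add0r opprK.
Qed.

Section PartialIsometry.
Context {H K : hilbertType R} {V : 'B(H, K)}.
Hypothesis isoV : partial_isometry V.

(** [V] preserves norms, hence real inner products, on the complement of its kernel. Both
    [x = adj V y] and [d = adj V (V x) - x] lie there, so [nrm d ^+ 2 = rdot (V x) (V d) - rdot x d
    = 0]. *)
Lemma partial_isometry_adjK : adj V ** V ** adj V = adj V.
Proof.
apply: bop_ext => y; rewrite !compE; set x := adj V y.
have xV z : V z = 0 -> '[x, z] = 0 by rewrite /x -adjPr => ->; rewrite dot0r.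
have [d dE] : exists d, d = adj V (V x) - x by exists (adj V (V x) - x).
have dV z : V z = 0 -> '[d, z] = 0.
  by move=> Vz; rewrite dE dotBl xV// -adjPr Vz dot0r subr0.
have iso w : (forall z, V z = 0 -> '[w, z] = 0) -> rdot (V w) (V w) = rdot w w.
  by move=> /isoV Vw; rewrite !rdotxx /nrm Vw.
have Vxd : rdot (V x) (V d) = rdot x d.
  have := iso (x + d); rewrite opD !(rdotDl, rdotDr) (rdotC (V d) (V x)).
  rewrite (rdotC d x) (iso _ xV) (iso _ dV) => isoxd.
  suff /isoxd : forall z, V z = 0 -> '[x + d, z] = 0 by lra.
  by move=> z Vz; rewrite dotDl xV// dV// addr0.
apply/subr0_eq/nrm_eq0/eqP; rewrite -sqrf_eq0 -rdotxx -dE {1}dE rdotDl rdotNl.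
by rewrite rdotC -radjP rdotC Vxd subrr eqxx.
Qed.

Lemma partial_isometry_VK : V ** adj V ** V = V.
Proof.
have := congr1 (@adj R K H) partial_isometry_adjK.
by rewrite !adj_comp adjK compA.
Qed.

End PartialIsometry.
End SupportProjection.

(** * Row operators and operator matrices *)

Section Blocks.
Context {R : realType} {H K : hilbertType R}.
Implicit Types L : hilbertType R.

Lemma dsum_eq (x y : dsum H K) : x.1 = y.1 -> x.2 = y.2 -> x = y.
Proof. by case: x y => [? ?] [? ?] /= -> ->. Qed.

Lemma row_bop_subproof L (A : 'B(H, L)) (B : 'B(K, L)) :
  (fun x : dsum H K => A x.1 + B x.2) \in bounded_op.
Proof.
have [[M M0 AM] [N N0 BN]] := (bop_ge0_bounded A, bop_ge0_bounded B).
apply: bop_mk_subproof => [a x y|].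
  change (A (a *: x.1 + y.1) + B (a *: x.2 + y.2) =
      a *: (A x.1 + B x.2) + (A y.1 + B y.2)).
  by rewrite !opD !opZ scalerDr addrACA.
exists (M + N) => x; apply: (le_trans (ler_normD _ _)); rewrite mulrDl lerD//.
  by rewrite (le_trans (AM _))// ler_wpM2l// dsum_norm_ge1.
by rewrite (le_trans (BN _))// ler_wpM2l// dsum_norm_ge2.
Qed.

Definition row_bop L (A : 'B(H, L)) (B : 'B(K, L)) : 'B(dsum H K, L) :=
  BOp (row_bop_subproof A B).

Lemma row_bopE L (A : 'B(H, L)) (B : 'B(K, L)) x :
  row_bop A B x = A x.1 + B x.2.
Proof. by []. Qed.

Lemma adj_row_bopE L (A : 'B(H, L)) (B : 'B(K, L)) y :
  adj (row_bop A B) y = (adj A y, adj B y) :> dsum H K.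
Proof.
apply: dot_ext => x; rewrite -adjPr row_bopE dotDr dsum_dotE /=.
by rewrite -!adjPr.
Qed.

Lemma block_ext (P Q : 'B(dsum H K, dsum H K)) :
  (forall x, (P x).1 = (Q x).1) -> (forall x, (P x).2 = (Q x).2) -> P = Q.
Proof. by move=> PQ1 PQ2; apply: bop_ext => x; apply: dsum_eq. Qed.

Lemma adj_block_bop (A : 'B(H, H)) (B : 'B(K, H)) (C : 'B(H, K)) (D : 'B(K, K))
  :
  adj (block_bop A B C D) = block_bop (adj A) (adj C) (adj B) (adj D).
Proof.
apply: adj_unique => x y; rewrite !dsum_dotE /=.
by rewrite !(dotDl, dotDr) !adjP addrACA.
Qed.

Lemma comp_row_adj_row L (A C : 'B(H, L)) (B D : 'B(K, L)) :
  row_bop A B ** adj (row_bop C D) = A ** adj C + B ** adj D.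
Proof. by apply: bop_ext => y; rewrite compE adj_row_bopE. Qed.

Lemma comp_adj_row_row L (A C : 'B(H, L)) (B D : 'B(K, L)) (G : 'B(L, L)) :
  adj (row_bop A B) ** G ** row_bop C D =
  block_bop (adj A ** G ** C) (adj A ** G ** D)
            (adj B ** G ** C) (adj B ** G ** D).
Proof.
apply: bop_ext => x; rewrite !compE adj_row_bopE row_bopE.
by apply: dsum_eq; rewrite /= !opD.
Qed.

End Blocks.

Section Inverses.
Context {R : realType}.
Implicit Types H K L : hilbertType R.

Lemma comp_inv_comm H (A X Xi : 'B(H, H)) : Xi ** X = \1 -> X ** Xi = \1 ->
  A ** X = X ** A -> A ** Xi = Xi ** A.
Proof.
move=> XiX XXi AX; rewrite -[LHS]comp1l -XiX -compA (compA X) -AX -compA XXi.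
by rewrite comp1r.
Qed.

Lemma positive_inv H (A X : 'B(H, H)) :
  positive_bop A -> A ** X = \1 -> positive_bop X.
Proof.
move=> A0 AX x; rewrite -[x in '[_, x]]idE -AX compE -{1}(positive_adj A0)
  -adjP.
exact: A0.
Qed.

(** This is the projection onto the range of [adj Z] when [Z ** adj Z] is invertible; [G] is
    self-adjoint as the inverse of a self-adjoint operator. *)
Lemma gram_proj H L (Z : 'B(L, H)) (G : 'B(H, H)) :
  G ** (Z ** adj Z) = \1 -> Z ** adj Z ** G = \1 ->
  let P := adj Z ** G ** Z in
  [/\ adj P = P, P ** P = P, P ** adj Z = adj Z & Z ** P = Z].
Proof.
move=> GZ ZG P.
have GG : adj G = G.
  have ZG' : Z ** adj Z ** adj G = \1.
    by rewrite -{1}[Z]adjK -adj_comp -adj_comp GZ adj1.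
  by rewrite -[adj G]comp1l -GZ -compA ZG' comp1r.
have PZ : P ** adj Z = adj Z by rewrite /P -compA -compA GZ comp1r.
have PP : adj P = P by rewrite /P adj_conj GG.
split=> //; first by rewrite {2}/P !compA PZ.
by rewrite -[RHS]adjK -PZ adj_comp PP adjK.
Qed.

Lemma adj_comp_eq0 H K (A : 'B(H, K)) : adj A ** A = 0 -> A = 0.
Proof.
move=> AA; apply: bop_ext => x; apply/nrm_eq0/eqP.
by rewrite -sqrf_eq0 -rdotxx radjP -compE AA bop0E /rdot dot0r.
Qed.

(** Such an [x] is orthogonal to every [A y], so [nrm x ^+ 2 = rdot x (x - A y) <= nrm x * nrm (x -
    A y)], where the last factor can be made arbitrarily small. *)
Lemma closure_range_ker H K (A : 'B(H, K)) x :
  closure (range A) x -> adj A x = 0 -> x = 0.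
Proof.
move=> /closureP Ax A0; apply/nrm_eq0/eqP; rewrite eq_le nrm_ge0 andbT.
apply/ler_addgt0Pr => e e0; rewrite add0r leNgt; apply/negP => ex.
have [_ [y _ <-] xy] := Ax _ e0; have := rdot_CS x (x - A y).
rewrite rdotDr rdotNr (rdotC x (A y)) radjP A0 {2}/rdot dot0r /= subr0 rdotxx.
by rewrite expr2 ler_pM2l; lra.
Qed.

End Inverses.

(** * The positive part of S *)

Section Modulus.
Context {R : realType} {H K : hilbertType R}.
Implicit Types (B : 'B(K, H)) (lam : R).

Lemma positive_comp_adj B : positive_bop (B ** adj B).
Proof. by rewrite -{1}[B]adjK; apply: positive_adj_comp. Qed.

Lemma T_bopP B lam (T := T_bop B lam) :
  [/\ positive_bop T,
      T ** T = (lam ^+ 2)%:C *: \1 + 4 *: (B ** adj B) &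
      forall G, G ** (B ** adj B) = B ** adj B ** G -> G ** T = T ** G].
Proof.
have [|T0 TT Tcomm] := @sqrt_bopP _ _ ((lam ^+ 2)%:C *: \1 + 4 *: (B ** adj B)).
  apply: positiveD; first exact/positiveZ/positive1/sqr_ge0.
  have -> : 4 = (4 : R)%:C by rewrite rmorph_nat.
  exact/positiveZ/positive_comp_adj.
split=> // G GB; apply: Tcomm.
by rewrite compDl compDr !compZl !compZr comp1l comp1r GB.
Qed.

(** [T] is bounded below by [|lam|], because [nrm (T x) ^+ 2 = lam ^+ 2 * nrm x ^+ 2 + 4 * rdot (B
    (adj B x)) x]. *)
Lemma T_bop_inv B lam (T := T_bop B lam) : lam != 0 ->
  [/\ inv_bop T ** T = \1, T ** inv_bop T = \1 & adj (inv_bop T) = inv_bop T].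
Proof.
move=> lam0; have [T0 TT _] := T_bopP B lam.
have T_adj := positive_adj T0.
apply: (@inv_bopP _ _ _ `|lam|) => //; first by rewrite normr_gt0.
move=> x; rewrite -(@ler_pXn2r _ 2) ?nnegrE ?mulr_ge0 ?nrm_ge0//.
rewrite exprMn real_normK ?num_real// -(rdotxx (T x)) radjP T_adj -compE TT.
rewrite rdotC !(bopDE, bopZE) idE compE.
have -> : 4 = (4 : R)%:C by rewrite rmorph_nat.
rewrite rdotDl !rdotZl rdotxx lerDl mulr_ge0//.
by case/positiveP: (positive_comp_adj B) => _ /(_ x).
Qed.

(** From [rdot (W x) x >= lam * nrm x ^+ 2], Cauchy-Schwarz yields the lower bound [lam]. *)
Lemma T_shift_inv B lam (W := lam%:C *: \1 + T_bop B lam) : 0 < lam ->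
  [/\ inv_bop W ** W = \1, W ** inv_bop W = \1 & adj (inv_bop W) = inv_bop W].
Proof.
move=> lam0; have [T0 _ _] := T_bopP B lam.
have [T_adj Tpos] := (positiveP _).1 T0.
apply: (@inv_bopP _ _ _ lam) => // [|x].
  by rewrite /W adjD adjZr adj1 T_adj.
have [->|x0] := eqVneq (nrm x) 0; first by rewrite mulr0 nrm_ge0.
rewrite -(@ler_pM2r _ (nrm x)); last by rewrite lt_def x0 nrm_ge0.
apply: le_trans (rdot_CS _ _).
by rewrite !(bopDE, bopZE) idE rdotDl rdotZl rdotxx -mulrA -expr2 lerDl Tpos.
Qed.

End Modulus.

Section Nonzero.
Context {R : realType} {H K : hilbertType R}.
Implicit Types (B : 'B(K, H)) (lam : R).

Lemma conj_half : Num.conj (2^-1 : R[i]) = 2^-1.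
Proof. by rewrite fmorphV rmorph_nat. Qed.

(* Replacing [(B, lam)] by [(-B, -lam)] exchanges [X] with [Y] and [Z] with
   [Z'], and leaves [T] unchanged. *)
Definition X_bop B lam : 'B(H, H) := 2^-1 *: (lam%:C *: \1 + T_bop B lam).
Definition Z_bop B lam : 'B(dsum H K, H) := row_bop (X_bop B lam) B.
Definition Sp_bop B lam :=
  adj (Z_bop B lam) ** inv_bop (T_bop B lam) ** Z_bop B lam.

Lemma T_bopN B lam : T_bop (- B) (- lam) = T_bop B lam.
Proof. by rewrite /T_bop sqrrN adjN compNl compNr opprK. Qed.

Lemma X_bop_adj B lam : adj (X_bop B lam) = X_bop B lam.
Proof.
have [T0 _ _] := T_bopP B lam.
by rewrite adjZ conj_half adjD adjZr adj1 (positive_adj T0).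
Qed.

Lemma X_bopT B lam : X_bop B lam ** T_bop B lam = T_bop B lam ** X_bop B lam.
Proof. by opvec. Qed.

Lemma X_bop_addN B lam : X_bop B lam + X_bop (- B) (- lam) = T_bop B lam.
Proof. by rewrite /X_bop T_bopN rmorphN; opvec. Qed.

(** The product is [(T + lam) (T - lam) / 4 = (T^2 - lam^2) / 4]. *)
Lemma X_bop_mulN B lam : X_bop B lam ** X_bop (- B) (- lam) = B ** adj B.
Proof.
have [_ TT _] := T_bopP B lam.
have -> : B ** adj B = 4^-1 *: (T_bop B lam ** T_bop B lam - (lam ^+ 2)%:C *:
  \1).
  by rewrite TT addrAC subrr add0r scalerA mulVf ?pnatr_eq0// scale1r.
by rewrite /X_bop T_bopN rmorphN rmorphXn; opvec.
Qed.

Lemma Z_bop_gram B lam : Z_bop B lam ** adj (Z_bop B lam) = X_bop B lam **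
  T_bop B lam.
Proof.
by rewrite comp_row_adj_row X_bop_adj -(X_bop_mulN B lam) -compDr X_bop_addN.
Qed.

Lemma Z_bop_mulN B lam : Z_bop B lam ** adj (Z_bop (- B) (- lam)) = 0.
Proof.
by rewrite comp_row_adj_row X_bop_adj adjN compNr X_bop_mulN subrr.
Qed.

Section Lam.
Variables (B : 'B(K, H)) (lam : R).
Hypothesis lam0 : lam != 0.
Let T := T_bop B lam.
Let Ti := inv_bop T.

Lemma Ti_positive : positive_bop Ti.
Proof.
have [T0 _ _] := T_bopP B lam; have [_ TTi _] := T_bop_inv B lam0.
exact: positive_inv T0 TTi.
Qed.

Lemma Sp_positive : positive_bop (Sp_bop B lam).
Proof. exact/positive_conj/Ti_positive. Qed.

(** The corner is [X T^-1 X = (T + 2 lam + lam^2 T^-1) / 4], and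
    [X T^-1 B = (B + lam T^-1 B) / 2]. *)
Lemma Sp_blockE : Sp_bop B lam = 2^-1 *: block_bop
      (2^-1 *: (T + (lam ^+ 2)%:C *: Ti + (2 * lam)%:C *: \1))
      (B + lam%:C *: (Ti ** B))
      (adj B + lam%:C *: (adj B ** Ti))
      (2 *: (adj B ** Ti ** B)).
Proof.
have [TiT TTi _] := T_bop_inv B lam0.
have TTix x : T (Ti x) = x by rewrite -compE TTi.
have TiTx x : Ti (T x) = x by rewrite -compE TiT.
rewrite /Sp_bop comp_adj_row_row X_bop_adj -/T -/Ti.
apply: block_ext => x.
  change (X_bop B lam (Ti (X_bop B lam x.1)) + X_bop B lam (Ti (B x.2)) =
    2^-1 *: ((2^-1 *: (T + (lam ^+ 2)%:C *: Ti + (2 * lam)%:C *: \1)) x.1 +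
      (B + lam%:C *: (Ti ** B)) x.2)).
  rewrite /X_bop -/T.
  rewrite ?(bopDE, bopNE, bopZE, bop0E, compE, idE, opD, opN, opZ, op0).
  by rewrite !(TTix, TiTx); vec.
change (adj B (Ti (X_bop B lam x.1)) + adj B (Ti (B x.2)) =
    2^-1 *: ((adj B + lam%:C *: (adj B ** Ti)) x.1 +
      (2 *: (adj B ** Ti ** B)) x.2)).
rewrite /X_bop -/T.
rewrite ?(bopDE, bopNE, bopZE, bop0E, compE, idE, opD, opN, opZ, op0).
by rewrite !(TTix, TiTx); vec.
Qed.

End Lam.

(** Changing the signs of [B] and [lam] keeps [T], [T^-1], [lam T^-1 B] and the lower right block,
    which cancel; only the terms in [lam], [B] and [adj B] survive. *)
Lemma Sp_sub B lam : lam != 0 -> S_bop B lam = Sp_bop B lam - Sp_bop (- B) (-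
  lam).
Proof.
move=> lam0; have lamN0 : - lam != 0 by rewrite oppr_eq0.
rewrite !Sp_blockE// T_bopN sqrrN; apply: block_ext => x.
  change ((lam%:C *: \1 : 'B(H, H)) x.1 + B x.2 =
    2^-1 *: ((2^-1 *: (T_bop B lam + (lam ^+ 2)%:C *: inv_bop (T_bop B lam) +
        (2 * lam)%:C *: \1)) x.1 +
      (B + lam%:C *: (inv_bop (T_bop B lam) ** B)) x.2) -
    2^-1 *: ((2^-1 *: (T_bop B lam + (lam ^+ 2)%:C *: inv_bop (T_bop B lam) +
        (2 * - lam)%:C *: \1)) x.1 +
      (- B + (- lam)%:C *: (inv_bop (T_bop B lam) ** (- B))) x.2)).
  have lam2 : (2 * lam)%:C = 2 * lam%:C by rewrite rmorphM rmorph_nat.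
  rewrite mulrN !rmorphN lam2.
  rewrite ?(bopDE, bopNE, bopZE, bop0E, compE, idE, opD, opN, opZ, op0).
  by vec.
change (adj B x.1 + (0 : 'B(K, K)) x.2 =
    2^-1 *: ((adj B + lam%:C *: (adj B ** inv_bop (T_bop B lam))) x.1 +
      (2 *: (adj B ** inv_bop (T_bop B lam) ** B)) x.2) -
    2^-1 *: ((adj (- B) + (- lam)%:C *: (adj (- B) ** inv_bop (T_bop B lam)))
      x.1 +
      (2 *: (adj (- B) ** inv_bop (T_bop B lam) ** - B)) x.2)).
rewrite adjN !rmorphN.
rewrite ?(bopDE, bopNE, bopZE, bop0E, compE, idE, opD, opN, opZ, op0).
by vec.
Qed.

Lemma pos_part_SE B lam : lam != 0 -> pos_part (S_bop B lam) = Sp_bop B lam.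
Proof.
move=> lam0; have lamN0 : - lam != 0 by rewrite oppr_eq0.
apply: (pos_part_decomp _ _ _ (Sp_sub B lam0)); try exact: Sp_positive.
by rewrite /Sp_bop conj_comp Z_bop_mulN comp0l !comp0r comp0l.
Qed.

(** The quadratic form of the positive operator [T^-1] vanishes at [Z x], so [T^-1 (Z x) = 0]. *)
Lemma Sp_ker B lam x : lam != 0 -> Sp_bop B lam x = 0 -> Z_bop B lam x = 0.
Proof.
move=> lam0 Sx; have [_ TTi _] := T_bop_inv B lam0.
rewrite -[LHS]idE -TTi compE (positive_ker (Ti_positive B lam0)) ?op0//.
by rewrite /rdot adjPr -[adj _ _]/(Sp_bop B lam x) Sx dot0l.
Qed.


(* The middle factor is [(X T)^-1 = (Z Z^* )^-1] when [0 < lam]. *)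
Definition Pp_bop B lam := adj (Z_bop B lam) **
  (2 *: (inv_bop (T_bop B lam) ** inv_bop (lam%:C *: \1 + T_bop B lam))) **
  Z_bop B lam.

(** * The support projection for positive [lam] *)

Section PosLam.
Variables (B : 'B(K, H)) (lam : R).
Hypothesis lam_gt0 : 0 < lam.
Let lam0 : lam != 0 := lt0r_neq0 lam_gt0.
Let T := T_bop B lam.
Let Ti := inv_bop T.
Let W := lam%:C *: \1 + T.
Let Wi := inv_bop W.
Let X := X_bop B lam.
Let Z := Z_bop B lam.
Let G : 'B(H, H) := 2 *: (Ti ** Wi).

Let GX : G ** X = Ti.
Proof.
have [WiW _ _] := T_shift_inv B lam_gt0.
rewrite /G /X /X_bop -/T -/W compZl compZr -compA WiW comp1r.
by rewrite scalerA divff ?pnatr_eq0// scale1r.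
Qed.

Let XG : X ** G = Ti.
Proof.
have [_ WWi _] := T_shift_inv B lam_gt0.
have [TiT TTi _] := T_bop_inv B lam0.
have WTi : W ** Ti = Ti ** W.
  by apply: comp_inv_comm TiT TTi _; opvec.
rewrite /G /X /X_bop -/T -/W compZl compZr compA WTi -compA WWi comp1r.
by rewrite scalerA mulVf ?pnatr_eq0// scale1r.
Qed.

Lemma Pp_proj (P := Pp_bop B lam) :
  [/\ adj P = P, P ** P = P, P ** adj Z = adj Z & Z ** P = Z].
Proof.
have [TiT TTi _] := T_bop_inv B lam0.
apply: gram_proj; rewrite Z_bop_gram -/T -/X.
  by rewrite compA GX.
by rewrite X_bopT -compA XG.
Qed.

Lemma Pp_blockE : Pp_bop B lam = block_bop
  (2^-1 *: (\1 + lam%:C *: Ti)) (Ti ** B) (adj B ** Ti)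
  (2 *: (adj B ** Ti ** Wi ** B)).
Proof.
have [TiT TTi _] := T_bop_inv B lam0.
rewrite /Pp_bop comp_adj_row_row X_bop_adj -/T -/Ti -/W -/Wi -/G -/X XG.
rewrite -(compA (adj B)) GX; congr block_bop.
  rewrite /X /X_bop -/T compZr compDr TiT compZr comp1r.
  by rewrite addrC.
by rewrite /G compZr compZl !compA.
Qed.

(** The projection fixes the range of [adj Z], which contains that of the positive part, and by
    [Sp_ker] it kills the kernel of the positive part. *)
Lemma supp_pos_part_gt0 : supp_proj (pos_part (S_bop B lam)) = Pp_bop B lam.
Proof.
have [PP PPP PZ ZP] := Pp_proj.
rewrite pos_part_SE//; apply: supp_proj_unique => //.
  by rewrite /Sp_bop !compA PZ.
move=> x; rewrite (positive_adj (Sp_positive B lam0)) => /(Sp_ker lam0) Zx.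
by rewrite /Pp_bop !compE Zx !op0.
Qed.

End PosLam.

End Nonzero.

(** * Support projections involving the polar decomposition *)

Section PolarDecomposition.
Context {R : realType} {H K : hilbertType R}.
Variables (B : 'B(K, H)) (V : 'B(H, K)).
Let N := sqrt_bop (B ** adj B).
Hypothesis isoV : partial_isometry V.
Hypothesis BV : adj B = V ** N.
Hypothesis ranV : range V = closure (range (adj B)).
Hypothesis ranV' : range (adj V) = closure (range B).
(** The initial and final projections of [V], later identified with the support projections of [B]
    and [adj B]. *)
Let E := adj V ** V.
Let F := V ** adj V.

Let N_props : [/\ adj N = N, N ** N = B ** adj B &
  forall G, G ** (B ** adj B) = B ** adj B ** G -> G ** N = N ** G].
Proof.
have [N0 NN Ncomm] := sqrt_bopP (positive_comp_adj B).
by split=> //; exact: positive_adj.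
Qed.

Let BE : B = N ** adj V.
Proof. by have [NA _ _] := N_props; rewrite -[LHS]adjK BV adj_comp NA. Qed.

Let E_adj : adj E = E. Proof. by rewrite adj_comp adjK. Qed.
Let F_adj : adj F = F. Proof. by rewrite adj_comp adjK. Qed.
Let EE : E ** E = E.
Proof. by rewrite /E compA partial_isometry_adjK. Qed.
Let FF : F ** F = F.
Proof. by rewrite /F compA partial_isometry_VK. Qed.

Let EB : E ** B = B.
Proof.
apply: bop_ext => y; rewrite compE.
have : closure (range B) (B y) by apply: subset_closure; exists y.
by rewrite -ranV' => -[z _ <-]; rewrite -compE partial_isometry_adjK.
Qed.

Let BF : B ** F = B.
Proof. by rewrite BE /F compA -(compA N) -(compA N) partial_isometry_adjK. Qed.

Lemma supp_proj_range : supp_proj B = E.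
Proof.
apply: supp_projE; split=> //; rewrite -ranV'; apply/seteqP; split=> _ [x _ <-].
  by exists (V x).
by exists (adj V x) => //; rewrite -compE partial_isometry_adjK.
Qed.

Lemma supp_proj_corange : supp_proj (adj B) = F.
Proof.
apply: supp_projE; split=> //; rewrite -ranV; apply/seteqP; split=> _ [x _ <-].
  by exists (adj V x).
by exists (V x) => //; rewrite -compE partial_isometry_VK.
Qed.

Let F_ker y : B (F y) = 0 -> F y = 0.
Proof.
move=> BFy; apply: (@closure_range_ker _ _ _ (adj B)); last by rewrite adjK.
by rewrite -ranV; exists (adj V y).
Qed.

(** [N (1 - E)] has Gram operator [(1 - E) B (adj B) (1 - E)], which vanishes because
    [E ** B = B]. *)
Let NE : N ** E = N.
Proof.
have [NA NN _] := N_props.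
apply/esym/subr0_eq/adj_comp_eq0.
have -> : N - N ** E = N ** (\1 - E) by rewrite compDr comp1r compNr.
rewrite adj_comp NA -compA (compA N) NN adjD adj1 adjN E_adj.
by rewrite compDl compNl comp1l (compA E) (compA E) EB subrr.
Qed.

Let EN : E ** N = N.
Proof. have [NA _ _] := N_props.
by have := congr1 (@adj R H H) NE; rewrite adj_comp E_adj NA. Qed.

(** [E x] lies in the closure of the range of [B], and [adj B (E x) = adj B x = V (N x) = 0]. *)
Let N_ker x : N x = 0 -> E x = 0.
Proof.
move=> Nx; apply: (@closure_range_ker _ _ _ B).
  by rewrite -ranV'; exists (V x).
apply: dot_ext => y.
by rewrite -adjPr dot0l adjP E_adj -compE EB adjPr BV compE Nx op0 dot0l.
Qed.

Lemma supp_pos_part_lt0 lam (T := T_bop B lam) : lam < 0 ->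
  supp_proj (pos_part (S_bop B lam)) =
  block_bop (2^-1 *: (\1 + lam%:C *: inv_bop T)) (inv_bop T ** B)
    (adj B ** inv_bop T)
    (2^-1 *: (V ** (\1 - lam%:C *: inv_bop T) ** adj V)).
Proof.
move=> lam_lt0; have lam0 : lam != 0 by rewrite lt_eqF.
have nlam_gt0 : 0 < - lam by rewrite oppr_gt0.
pose D : 'B(dsum H K, dsum H K) := block_bop \1 0 0 F.
pose Zp := Z_bop B lam; pose Zm := Z_bop (- B) (- lam).
(* Since [- lam] is positive, the previous case applies to [(- B, - lam)]; [P] is the support
   projection of the negative part. *)
pose P := Pp_bop (- B) (- lam).
have [PA PP ZmP] : [/\ adj P = P, P ** P = P & Zm ** P = Zm].
  by case: (Pp_proj (- B) nlam_gt0).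
have DA : adj D = D by rewrite adj_block_bop adj1 !adj0 F_adj.
have DD : D ** D = D.
  apply: block_ext => x; first by rewrite /= !addr0.
  by rewrite /= !add0r -[LHS]/((F ** F) x.2) FF.
have rowD (A : 'B(H, H)) (C : 'B(K, H)) : C ** F = C ->
    row_bop A C ** D = row_bop A C.
  move=> CF; apply: bop_ext => x; rewrite compE !row_bopE /= addr0 add0r.
  by rewrite -[X in _ + X]/((C ** F) x.2) CF.
have ZpD : Zp ** D = Zp by apply/rowD/BF.
have ZmD : Zm ** D = Zm by apply/rowD; rewrite compNl BF.
have PD : P ** D = P by rewrite /P /Pp_bop -compA ZmD.
have DP : D ** P = P by have := congr1 (@adj R _ _) PD; rewrite adj_comp DA PA.
have ZpP : Zp ** P = 0.
  by rewrite /P /Pp_bop !compA Z_bop_mulN !comp0l.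
transitivity (D - P).
  rewrite pos_part_SE//; apply: supp_proj_unique.
  - by rewrite adjD adjN DA PA.
  - rewrite compDl compNl !compDr !compNr DD DP PD PP.
    by rewrite subrr oppr0 addr0.
  - rewrite compDl compNl /Sp_bop !compA -{1}DA -{1}PA -!adj_comp ZpD ZpP.
    by rewrite adj0 !comp0l subr0.
  move=> x; rewrite (positive_adj (Sp_positive B lam0)) => /(Sp_ker lam0) Zpx.
  (* Both rows kill [p]. Their sum acts as [T] on the first component, so [p.1 = 0]; then
     [B p.2 = 0] with [p.2] in the range of [F], which forces [p.2 = 0]. *)
  set p := (D - P) x.
  have Zpp : Zp p = 0.
    by rewrite -compE compDr compNr ZpD ZpP subr0.
  have Zmp : Zm p = 0.
    by rewrite -compE compDr compNr ZmD ZmP subrr.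
  have Dp : D p = p by rewrite -compE compDr compNr DD DP.
  have [TiT _ _] := T_bop_inv B lam0.
  have p1 : p.1 = 0.
    rewrite -[LHS]idE -TiT -(X_bop_addN B lam) compE bopDE.
    suff -> : X_bop B lam p.1 + X_bop (- B) (- lam) p.1 = Zp p + Zm p.
      by rewrite Zpp Zmp addr0 op0.
    by rewrite !row_bopE bopNE addrACA subrr addr0.
  have Fp : F p.2 = p.2.
    by move/(congr1 snd): Dp; rewrite /= add0r.
  apply: dsum_eq => //; rewrite -[LHS]Fp; apply: F_ker; rewrite Fp.
  by move: Zpp; rewrite row_bopE p1 op0 add0r.
have [TiT TTi Ti_adj] := T_bop_inv B lam0.
have [_ _ Tcomm] := T_bopP B lam.
have [NA NN _] := N_props.
have TN : N ** T = T ** N by apply: Tcomm; rewrite -NN compA.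
have NTi : N ** inv_bop T = inv_bop T ** N by exact: comp_inv_comm TiT TTi TN.
rewrite /P Pp_blockE// T_bopN.
set Ti := inv_bop T in TiT TTi NTi Ti_adj *.
have [WiW WWi _] := T_shift_inv (- B) nlam_gt0; rewrite T_bopN -/T in WiW WWi.
set Wi := inv_bop _ in WiW WWi *.
have NWi : N ** Wi = Wi ** N.
  apply: comp_inv_comm WiW WWi _.
  by rewrite compDl compDr compZl compZr comp1l comp1r TN.
have WiY : Wi ** X_bop (- B) (- lam) = 2^-1 *: \1.
  by rewrite /X_bop T_bopN -/T compZr WiW.
have YX : X_bop (- B) (- lam) ** X_bop B lam = B ** adj B.
  have := X_bop_mulN (- B) (- lam).
  by rewrite !opprK adjN compNl compNr opprK.
(* Write [B = N ** adj V] and move both factors [N] together through [Ti] and [Wi]. As [Wi] is half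
   the inverse of [Y = X_bop (- B) (- lam)] and [Y X = N^2], the product [2 Wi N^2] is [X]. *)
have key : 2 *: (adj (- B) ** Ti ** Wi ** (- B)) =
    V ** (Ti ** X_bop B lam) ** adj V.
  have -> : X_bop B lam = 2 *: (Wi ** (B ** adj B)).
    by rewrite -YX compA WiY compZl comp1l scalerA divff ?pnatr_eq0// scale1r.
  rewrite adjN !compNl compNr opprK -NN compZr compZr compZl; congr (_ *: _).
  transitivity (V ** N ** Ti ** Wi ** (N ** adj V)); first by rewrite -BV -BE.
  have NTix x : N (Ti x) = Ti (N x) by rewrite -!compE NTi.
  have NWix x : N (Wi x) = Wi (N x) by rewrite -!compE NWi.
  by apply: bop_ext => x; rewrite !compE NTix NWix.
have TiTx x : Ti (T x) = x by rewrite -compE TiT.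
rewrite key adjN rmorphN; apply: block_ext => x.
  change ((\1 : 'B(H, H)) x.1 + (0 : 'B(K, H)) x.2 -
    ((2^-1 *: (\1 + - lam%:C *: Ti)) x.1 + (Ti ** - B) x.2) =
    (2^-1 *: (\1 + lam%:C *: Ti)) x.1 + (Ti ** B) x.2).
  by rewrite ?(bopDE, bopNE, bopZE, bop0E, compE, idE, opD, opN, opZ, op0); vec.
change ((0 : 'B(H, K)) x.1 + (V ** adj V) x.2 -
    ((- adj B ** Ti) x.1 + (V ** (Ti ** X_bop B lam) ** adj V) x.2) =
    (adj B ** Ti) x.1 + (2^-1 *: (V ** (\1 - lam%:C *: Ti) ** adj V)) x.2).
rewrite /X_bop -/T.
rewrite ?(bopDE, bopNE, bopZE, bop0E, compE, idE, opD, opN, opZ, op0) TiTx.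
by vec.
Qed.

(** The positive part is half of [adj Zp ** N ** Zp]. Because [Zp ** adj Zp = 1 + E] acts as 2 on
    the range of [E], half of [adj Zp ** E ** Zp] is idempotent and serves as its support
    projection. *)
Lemma supp_pos_part_0 :
  supp_proj (pos_part (S_bop B 0)) =
  2^-1 *: block_bop (supp_proj B) (adj V) V (supp_proj (adj B)).
Proof.
have [NA NN _] := N_props.
have [N0 _ _] := sqrt_bopP (positive_comp_adj B).
pose Zp : 'B(dsum H K, H) := row_bop \1 (adj V).
pose Zm : 'B(dsum H K, H) := row_bop \1 (- adj V).
pose P (Z : 'B(dsum H K, H)) := (2^-1)%:C *: (adj Z ** N ** Z).
have P0 Z : positive_bop (P Z).
  by apply: positiveZ; rewrite ?invr_ge0//; apply: positive_conj.
have ZZp : Zp ** adj Zp = \1 + E.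
  by rewrite comp_row_adj_row adj1 comp1l adjK.
have ZZm : Zp ** adj Zm = \1 - E.
  by rewrite comp_row_adj_row adj1 comp1l adjN adjK compNr.
have half2 : (2^-1)%:C = 2^-1 :> R[i] by rewrite fmorphV rmorph_nat.
have SE : pos_part (S_bop B 0) = P Zp.
  apply: (@pos_part_decomp _ _ _ (P Zp) (P Zm)) => //.
    rewrite /P compZl compZr conj_comp ZZm (compA N).
    by rewrite compDr compNr comp1r NE subrr comp0l comp0r comp0l !scaler0.
  rewrite /P half2 !comp_adj_row_row adj1 !adjN adjK.
  have BVx x : adj B x = V (N x) by rewrite BV.
  have BEx x : B x = N (adj V x) by rewrite {1}BE.
  apply: block_ext => x.
    change ((0%:C *: \1 : 'B(H, H)) x.1 + B x.2 =
      2^-1 *: ((\1 ** N ** \1) x.1 + (\1 ** N ** adj V) x.2) -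
      2^-1 *: ((\1 ** N ** \1) x.1 + (\1 ** N ** - adj V) x.2)).
    rewrite BEx rmorph0.
    by rewrite ?(bopDE, bopNE, bopZE, bop0E, compE, idE, opD, opN, opZ, op0);
      vec.
  change (adj B x.1 + (0 : 'B(K, K)) x.2 =
      2^-1 *: ((V ** N ** \1) x.1 + (V ** N ** adj V) x.2) -
      2^-1 *: ((- V ** N ** \1) x.1 + (- V ** N ** - adj V) x.2)).
  rewrite BVx.
  by rewrite ?(bopDE, bopNE, bopZE, bop0E, compE, idE, opD, opN, opZ, op0); vec.
rewrite SE supp_proj_range supp_proj_corange.
have EpE : (\1 + E) ** E = 2 *: E.
  by rewrite compDl comp1l EE scaler_nat.
have EpN : (\1 + E) ** N = 2 *: N.
  by rewrite compDl comp1l EN scaler_nat.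
have two_half : 2^-1 * (2^-1 * 2) = 2^-1 :> R[i] by rewrite mulVf ?mulr1
  ?pnatr_eq0.
transitivity (2^-1 *: (adj Zp ** E ** Zp)); last first.
  congr (_ *: _); rewrite comp_adj_row_row adj1 adjK !comp1l !comp1r.
  rewrite partial_isometry_adjK // /E compA partial_isometry_VK//.
apply: supp_proj_unique.
- by rewrite adjZ conj_half adj_conj E_adj.
- rewrite compZl compZr conj_comp ZZp EpE.
  by rewrite compZr EE compZr compZl !scalerA -mulrA two_half.
- rewrite /P half2 compZl compZr conj_comp ZZp EpN.
  by rewrite compZr EN compZr compZl !scalerA -mulrA two_half.
move=> x; rewrite (positive_adj (P0 Zp)) => Px.
(* Applying [Zp] to the positive part at [x] gives [(1 + E) N (Zp x) / 2 = N (Zp x)]. *)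
have : N (Zp x) = 0.
  have : Zp (P Zp x) = 0 by rewrite Px op0.
  rewrite -compE /P half2 compZr (compA Zp) (compA Zp) ZZp EpN compZl scalerA
    mulVf ?pnatr_eq0//.
  by rewrite scale1r.
by move=> /N_ker EZ; rewrite bopZE compE compE EZ op0 scaler0.
Qed.

End PolarDecomposition.

Theorem theorem10 (R : realType) (H K : hilbertType R) (B : 'B(K, H)) :
  let half : R[i] := 2^-1 in
  (* (i) *)
  (forall lam : R, lam != 0 ->
    let T := T_bop B lam in
    pos_part (S_bop B lam) =
    half *: block_bop
      (half *: (T + (lam ^+ 2)%:C *: inv_bop T + (2 * lam)%:C *: \1))
      (B + lam%:C *: (inv_bop T ** B))
      (adj B + lam%:C *: (adj B ** inv_bop T))
      (2 *: (adj B ** inv_bop T ** B))) /\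
  (* (ii) *)
  (let T := T_bop B 1 in
    T = sqrt_bop (\1 + 4 *: (B ** adj B)) /\
    supp_proj (pos_part (S_bop B 1)) =
    block_bop
      (half *: (\1 + inv_bop T))
      (inv_bop T ** B)
      (adj B ** inv_bop T)
      (2 *: (adj B ** inv_bop T ** inv_bop (\1 + T) ** B))) /\
  (* (iii) *)
  (forall lam : R, 0 < lam ->
    let T := T_bop B lam in
    supp_proj (pos_part (S_bop B lam)) =
    block_bop
      (half *: (\1 + lam%:C *: inv_bop T))
      (inv_bop T ** B)
      (adj B ** inv_bop T)
      (2 *: (adj B ** inv_bop T ** inv_bop (lam%:C *: \1 + T) ** B))) /\
  (* the partial isometry V of the polar decomposition, for (iv) and (v) *)
  (forall V : 'B(H, K),
    partial_isometry V ->
    adj B = V ** sqrt_bop (B ** adj B) ->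
    range V = closure (range (adj B)) ->
    range (adj V) = closure (range B) ->
    (* (iv) *)
    (forall lam : R, lam < 0 ->
      let T := T_bop B lam in
      supp_proj (pos_part (S_bop B lam)) =
      block_bop
        (half *: (\1 + lam%:C *: inv_bop T))
        (inv_bop T ** B)
        (adj B ** inv_bop T)
        (half *: (V ** (\1 - lam%:C *: inv_bop T) ** adj V))) /\
    (* (v) *)
    supp_proj (pos_part (S_bop B 0)) =
    half *: block_bop (supp_proj B) (adj V) V (supp_proj (adj B))).
Proof.
move=> half; split; [|split; [|split]].
- by move=> lam lam0 T; rewrite pos_part_SE// Sp_blockE.
- split; first by rewrite /T_bop expr1n rmorph1 scale1r.
  by rewrite supp_pos_part_gt0// Pp_blockE// rmorph1 !scale1r.
- by move=> lam lam0 T; rewrite supp_pos_part_gt0// Pp_blockE.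
- move=> V isoV BV ranV ranV'; split; last exact: supp_pos_part_0.
  by move=> lam lam0 T; exact: supp_pos_part_lt0.
Qed.
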